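(* Let $m\ge1$, $n\ge1$, $1\le p_1,\dots,p_m<\infty$, $X=\bigoplus_{i=1}^m\ell^{p_i}$ with any fixed absolute norm on the sum, and let $V\subset X$ be an $n$-dimensional subspace. The support of the grading of the Plücker coordinates of $V$ by compositions $\vec a=(a_1,\dots,a_m)$ of $n$ is the set of lattice points of the generalized permutohedron $$\mathcal P(V)=\Big\{\vec a\in\mathbb R_{\ge0}^m:\ \sum_ia_i=n,\ \ \sum_{i\in S}a_i\le\dim\pi_S(V)\ \ \forall S\subseteq[m]\Big\},$$ where $\pi_S$ is the projection of $X$ to $\bigoplus_{i\in S}\ell^{p_i}$; equivalently, the lower facets are cut by the intersection dimensions, $\sum_{i\in T}a_i\ge\dim\big(V\cap\bigoplus_{i\in T}\ell^{p_i}\big)$ for $T\subseteq[m]$. The support is M-convex in the sense of discrete convex analysis; $\mathcal P(V)$ is the matroid base polytope of the colored column matroid, achievability of a composition being an instance of Rado/matroid union. For $m=2$ this degenerates to: the support is $\{(a,n-a):\dim(V\cap\ell^{p_1})\le a\le n-\dim(V\cap\ell^{p_2})\}$. The global exponent is $\max_ip_i$ (attained on the corresponding pure corner). If moreover the $p_i$ are distinct and $\neq2$ and the sum norm is absolute, normalized and strictly monotone, the entire face stratification is invariant under $\operatorname{Isom}(X)=\prod_i\operatorname{Isom}(\ell^{p_i})$.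
   Context: Scalars are complex. Write $[m]=\{1,\dots,m\}$ and let $\ell^{p_i}=\ell^{p_i}(A_i)$ with $A_1,\dots,A_m$ disjoint copies of $\mathbb N$; vectors of $X$ are functions on $A=\bigsqcup_iA_i$, totally ordered. For a basis $v_1,\dots,v_n$ of $V$ and an $n$-element $I=\{i_1<\dots<i_n\}\subset A$, $p_I=\det(v_r(i_s))_{r,s}$ (defined up to a common scalar). A composition of $n$ is $\vec a\in\mathbb Z_{\ge0}^m$ with $\sum a_i=n$; the block of type $\vec a$ is $\beta_{\vec a}(V)=(p_I)$ over $I$ with $|I\cap A_i|=a_i$ for all $i$, and the support of the grading is $\{\vec a:\beta_{\vec a}(V)\ne0\}$. A set $B\subset\mathbb Z^m$ is M-convex if it is nonempty and for all $x,y\in B$ and $i$ with $x_i>y_i$ there is $j$ with $x_j<y_j$ such that $x-e_i+e_j\in B$ and $y+e_i-e_j\in B$. The colored column matroid of $V$ is the matroid on ground set $A$ represented by the columns $(v_r(k))_{r}\in\mathbb C^n$, $k\in A$, with $k$ colored by the $i$ such that $k\in A_i$; its base polytope in composition coordinates is the convex hull of the color-count vectors $(|I\cap A_i|)_i$ of its bases $I$. The global exponent is the least $s$ such that $(p_I)\in\ell^s\binom{A}{n}$ for every $n$-frame in $X$; the pure corner of summand $i$ is $\vec a=n e_i$, i.e. subspaces contained in $\ell^{p_i}$. The face stratification of $\mathrm{Gr}_n(X)$ (the set of $n$-dimensional subspaces) is its partition according to the polytope $\mathcal P(V)$. $\operatorname{Isom}$ denotes the group of surjective linear isometries. The sum norm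 has the form $N(\|x_1\|_{p_1},\dots,\|x_m\|_{p_m})$ for a norm $N$ on $\mathbb R^m$ depending only on absolute values (absolute); it is normalized if $N(e_i)=1$ for all $i$, and strictly monotone if $N(s)<N(t)$ whenever $0\le s\le t$ coordinatewise and $s\ne t$. *)

(* Defs.v *)
From HB Require Import structures.
From mathcomp Require Import all_boot all_order all_algebra finmap.
From mathcomp Require Import complex.
From mathcomp Require Import all_classical all_reals all_analysis.

Set Implicit Arguments.
Unset Strict Implicit.
Unset Printing Implicit Defensive.

Import Order.TTheory GRing.Theory Num.Theory Order.LexiSyntax.

Local Open Scope classical_set_scope.
Local Open Scope ring_scope.

Section LinearAlgebra.
Variables (K : fieldType) (E : lmodType K).

Definition lin_indep n (v : 'I_n -> E) : Prop :=
  forall c : 'I_n -> K, \sum_r c r *: v r = 0 -> forall r, c r = 0.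

Definition lin_span n (v : 'I_n -> E) : set E :=
  [set x | exists c : 'I_n -> K, x = \sum_r c r *: v r].

Definition is_basis n (v : 'I_n -> E) (V : set E) : Prop :=
  lin_indep v /\ lin_span v = V.

Definition has_dim (V : set E) (n : nat) : Prop :=
  exists v : 'I_n -> E, is_basis v V.

(* The value 0 for a set that has no finite basis is junk: [subspace_dim] is only
   applied to images and subspaces of finite-dimensional subspaces. *)
Definition subspace_dim (V : set E) : nat := xget 0%N [set n | has_dim V n].

(* Linear maps and isometries are only constrained on the subspace [X] of [E]
   where the norm [nu] is meaningful; equality of such maps is equality on [X]. *)
Definition surj_lin_isometry (R : realType) (X : set E) (nu : E -> R)
    (T : E -> E) : Prop :=
  [/\ T @` X = X,
      forall (c : K) x y, X x -> X y -> T (c *: x + y) = c *: T x + T y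
    & forall x, X x -> nu (T x) = nu x].

End LinearAlgebra.

Section Sequences.
Variable R : realType.
Local Notation C := R[i].

Definition modulus (z : C) : R := complex.Re `|z|.

Definition ell (J : choiceType) (D : set J) (s : R) : set (J -> C) :=
  [set f | summable D (fun k => (modulus (f k) `^ s)%:E)].

Definition ellnorm (p : R) (f : nat -> C) : R :=
  fine (\esum_(k in [set: nat]) (modulus (f k) `^ p)%:E) `^ p^-1.

End Sequences.

(* The disjoint union of [m] copies of the natural numbers: [(i, l)] is the [l]-th
   element of the [i]-th copy, and the total order is lexicographic. *)
Notation idx m := ('I_m *l nat)%type.
Notation color k := (k.1).

Section Sum.
Variables (R : realType) (m : nat).
Local Notation C := R[i].

Definition vect : Type := idx m -> C.
HB.instance Definition _ := GRing.Lmodule.on vect.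

Definition part (x : vect) (i : 'I_m) : nat -> C := fun l => x (i, l).

Definition sum_ell (p : 'I_m -> R) : set vect :=
  [set x | forall i, ell [set: nat] (p i) (part x i)].

Definition sub_sum (p : 'I_m -> R) (S : {set 'I_m}) : set vect :=
  [set x | sum_ell p x /\ forall k, color k \notin S -> x k = 0].

Definition summand_proj (S : {set 'I_m}) (x : vect) : vect :=
  fun k => if color k \in S then x k else 0.

Record absolute_norm (N : 'rV[R]_m -> R) : Prop := AbsoluteNorm {
  anorm_definite : forall t, N t = 0 -> t = 0;
  anorm_homog : forall c t, N (c *: t) = `|c| * N t;
  anorm_triangle : forall t u, N (t + u) <= N t + N u;
  anorm_absolute : forall t u : 'rV[R]_m,
    (forall i, `|t ord0 i| = `|u ord0 i|) -> N t = N u }.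

Definition normalized (N : 'rV[R]_m -> R) : Prop :=
  forall i, N (delta_mx ord0 i) = 1.

Definition strictly_monotone (N : 'rV[R]_m -> R) : Prop :=
  forall t u : 'rV[R]_m,
    (forall i, 0 <= t ord0 i) -> (forall i, t ord0 i <= u ord0 i) ->
    t != u -> N t < N u.

Definition sum_norm (p : 'I_m -> R) (N : 'rV[R]_m -> R) (x : vect) : R :=
  N (\row_i ellnorm (p i) (part x i)).

Definition Isom (p : 'I_m -> R) (N : 'rV[R]_m -> R) : set (vect -> vect) :=
  [set T | surj_lin_isometry (sum_ell p) (sum_norm p N) T].

(* The coordinatewise action of the product of the groups Isom(l^{p_i}). *)
Definition prod_Isom (p : 'I_m -> R) : set (vect -> vect) :=
  [set T | exists U : 'I_m -> (nat -> C) -> (nat -> C),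
     (forall i,
        surj_lin_isometry (ell [set: nat] (p i)) (ellnorm (p i)) (U i)) /\
     forall x, sum_ell p x -> forall i, part (T x) i = U i (part x i)].

End Sum.

Section Plucker.
Variables (R : realType) (m n : nat).
Local Notation C := R[i].
Local Notation A := (idx m).
Local Notation vect := (vect R m).

Definition nframe (p : 'I_m -> R) (v : 'I_n -> vect) : Prop :=
  lin_indep v /\ forall r, sum_ell p (v r).

Definition Gr (p : 'I_m -> R) : set (set vect) :=
  [set V | has_dim V n /\ V `<=` sum_ell p].

(* An [n]-element subset of the index set is encoded by its increasing
   enumeration. *)
Definition nsubsets : set (n.-tuple A) := [set I | sorted <%O (I : seq A)].

Definition plucker (v : 'I_n -> vect) (I : n.-tuple A) : C :=
  \det (\matrix_(r < n, s < n) v r (tnth I s)).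

Definition color_count (I : seq A) : 'rV[int]_m :=
  \row_i (count (fun k => color k == i) I)%:Z.

Definition composition (a : 'rV[int]_m) : Prop :=
  (forall i, 0 <= a ord0 i) /\ \sum_i a ord0 i = n%:Z.

Definition block_index (a : 'rV[int]_m) : set (n.-tuple A) :=
  [set I | nsubsets I /\ color_count I = a].

(* Another basis of the same subspace multiplies all Plücker coordinates by a
   common nonzero scalar, hence has the same [plucker_support]. *)
Definition plucker_support (v : 'I_n -> vect) : set 'rV[int]_m :=
  [set a | composition a /\ exists2 I, block_index a I & plucker v I != 0].

Definition all_plucker_ell (v : 'I_n -> vect) (s : R) : Prop :=
  ell nsubsets s (plucker v).

Definition is_global_exponent (p : 'I_m -> R) (s : R) : Prop :=
  let admissible t :=
    0 < t /\ forall v, nframe p v -> all_plucker_ell v t in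
  admissible s /\ forall t, admissible t -> s <= t.

End Plucker.

Section Polytopes.
Variables (R : realType) (m n : nat).
Local Notation vect := (vect R m).

Definition toR (a : 'rV[int]_m) : 'rV[R]_m := map_mx intr a.

Definition lattice_points (Q : set 'rV[R]_m) : set 'rV[int]_m :=
  [set a | Q (toR a)].

Definition polytope (V : set vect) : set 'rV[R]_m :=
  [set a : 'rV[R]_m | [/\ forall i, 0 <= a ord0 i,
               \sum_i a ord0 i = n%:R
             & forall S : {set 'I_m},
                 \sum_(i in S) a ord0 i <=
                   (subspace_dim (summand_proj S @` V))%:R]].

Definition polytope_lower (p : 'I_m -> R) (V : set vect) : set 'rV[R]_m :=
  [set a : 'rV[R]_m | [/\ forall i, 0 <= a ord0 i,
               \sum_i a ord0 i = n%:R
             & forall T : {set 'I_m},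
                 (subspace_dim (V `&` sub_sum p T))%:R <=
                   \sum_(i in T) a ord0 i]].

Definition generalized_permutohedron (Q : set 'rV[R]_m) : Prop :=
  exists f : {set 'I_m} -> R,
    [/\ f finset.set0 = 0,
        forall S T : {set 'I_m}, f (S :|: T) + f (S :&: T) <= f S + f T
      & Q = [set a : 'rV[R]_m | \sum_i a ord0 i = f [set: 'I_m]%SET /\
               forall S : {set 'I_m}, \sum_(i in S) a ord0 i <= f S]].

Definition convex_hull (B : set 'rV[R]_m) : set 'rV[R]_m :=
  smallest (@convex_set R 'rV[R]_m) B.

Definition M_convex (B : set 'rV[int]_m) : Prop :=
  B !=set0 /\
  forall x y, B x -> B y -> forall i, y ord0 i < x ord0 i ->
    exists j, [/\ x ord0 j < y ord0 j,
                  B (x - delta_mx ord0 i + delta_mx ord0 j)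
                & B (y + delta_mx ord0 i - delta_mx ord0 j)].

Definition stratum (p : 'I_m -> R) (Q : set 'rV[R]_m) : set (set vect) :=
  [set V | Gr n p V /\ polytope V = Q].

Definition face_stratification (p : 'I_m -> R) : set (set (set vect)) :=
  [set stratum p (polytope V) | V in Gr n p].

End Polytopes.

Section ColumnMatroid.
Variables (R : realType) (m n : nat) (v : 'I_n -> vect R m).
Local Notation A := (idx m).

Definition column (k : A) : 'cV[R[i]]_n := \col_r v r k.

Definition col_indep (J : {fset A}) : Prop := free [seq column k | k <- J].

Definition col_base (B : {fset A}) : Prop :=
  col_indep B /\
  forall J : {fset A}, col_indep J -> (B `<=` J)%fset -> J = B.

(* [r] is at most the rank of [Y] in the column matroid. *)
Definition le_col_rank (r : nat) (Y : set A) : Prop :=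
  exists J : {fset A}, [/\ col_indep J, [set` J] `<=` Y & (r <= #|` J|)%N].

Definition base_polytope : set 'rV[R]_m :=
  convex_hull [set toR R (color_count B) | B in col_base].

(* Rado's setting: the family of [n] subsets of the ground set whose [r]-th member
   is the class of color [c r]. *)
Definition indep_transversal (c : 'I_n -> 'I_m) : Prop :=
  exists t : 'I_n -> A, [/\ injective t, forall r, color (t r) = c r
    & col_indep [fset t r | r in 'I_n]%fset].

Definition Rado_condition (c : 'I_n -> 'I_m) : Prop :=
  forall J : {set 'I_n},
    le_col_rank #|J| [set k | exists2 r, r \in J & color k = c r].

End ColumnMatroid.

(* Main.v *)
(** For each color [i] the columns of color [i] span a subspace [W_i] of [C^n], and
    [dim pi_S(V) = dim (sum_(i in S) W_i)] is a submodular function of [S]. Integer points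
    of its base polytope are realized by bases of columns through Rado's theorem; tight
    sets (those with equality) form a lattice, which gives the exchange property and, by
    pushing a fractional point along [e_i - e_j], the integrality of the polytope.

    The Leibniz expansion bounds [|p_I|^s] by [(n!)^s prod_(k in I) H k] with
    [H k = sum_r |v_r k|^s] summable; conversely a frame of standard vectors completed by
    one vector of [l^p] lying in no smaller [l^t] shows that the exponent is sharp.

    For an isometry [T] and a unit vector [e_k], the operator [1 + (lam - 1) Q] with
    [Q = T (e_k^* (x) e_k) T^-1] of rank one is an isometry for all unimodular [lam], so
    [phi (Q x)] is real whenever [phi] norms [x]. Testing this on vectors with two or three
    nonzero coordinates and varying their moduli forces, as [p_i <> 2], all off-diagonal
    entries of [Q] to vanish: [T] permutes the basis up to unimodular factors. Comparing
    [||e_k + e_l|| = 2^(1/p_i)] shows that colors are preserved. *)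
Require Import Defs.
From HB Require Import structures.
From mathcomp Require Import all_boot all_order all_algebra finmap.
From mathcomp Require Import complex.
From mathcomp Require Import all_classical all_reals all_analysis.
From mathcomp Require Import perm zify lra ring.

Set Implicit Arguments.
Unset Strict Implicit.
Unset Printing Implicit Defensive.

Import Order.TTheory GRing.Theory Num.Theory Order.LexiSyntax.

Local Open Scope classical_set_scope.
Local Open Scope ring_scope.

(** Vectors of [V] live on an infinite set, but all columns lie in [C^n]. The lemma [column_basis]
    turns dimensions of projections and intersections of [V] into ranks of finite families of
    columns.

    In the isometry part, one norming functional yields one real-linear relation between the entry
    [f k * g (e_ l)] of [Q] and the conjugate of the transposed entry. Two relations with different
    coefficient ratios make the entry vanish, and the ratio depends on the moduli exactly because
    [p i != 2]: at exponent 2, rotations do mix coordinates. Inside one color the moduli vary in the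
    plane of [k] and [l]. Across two colors a supporting functional of [N] is at hand only at one
    point of the segment, so the weight of color [i] is split over a third coordinate of that color
    and varied there.

    Vanishing on basis vectors extends to [X] because the exponents are finite, so truncations
    converge. Comparing norms of [e_k + e_l] settles colors only when two images share a color;
    pigeonhole provides such a pair, and for a coordinate that moved from color [i] to [j], [T] and
    its inverse together give [2^(1/p_i) = N (e_i + e_j) = 2^(1/p_j)]. *)

(** * Linear Rado theorem *)

Section ColumnSpan.
Variables (K : fieldType) (vT : vectType K) (J : choiceType) (col : J -> vT).
Implicit Types (D E : set J) (U : {vspace vT}) (s : seq J).

(** A free family in [D] that does not yet span can be lengthened, and its length is bounded by
    [\dim {:vT}]; the induction is on the remaining room [e]. *)
Lemma maximal_free_seq D : exists s : seq J,
  [/\ forall k, k \in s -> D k, free (map col s)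
    & forall k, D k -> col k \in <<map col s>>%VS].
Proof.
pose good s := (forall k, k \in s -> D k) /\ free (map col s).
suff H e s : good s -> (\dim {:vT} - size s <= e)%N -> exists s : seq J,
    [/\ forall k, k \in s -> D k, free (map col s)
      & forall k, D k -> col k \in <<map col s>>%VS].
  by apply: (H _ [::]) (leqnn _); split=> //=; rewrite nil_free.
elim: e s => [|e IH] s [sD fs] hs.
all: case: (pselect (forall k, D k -> col k \in <<map col s>>%VS)) => [h|].
all: try by exists s.
all: move/existsNP => -[k] /not_implyP[Dk] /negP kn.
all: have fks : free (map col (k :: s)) by rewrite /= free_cons kn.
all: have := dimvS (subvf <<map col (k :: s)>>%VS).
all: have /eqP -> := fks; rewrite size_map /= => hd.
  by move: hs hd => /=; lia.
apply: (IH (k :: s)); first split=> // l.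
  by rewrite inE => /predU1P[->|/sD].
by move: hs hd => /=; lia.
Qed.

(** Since [D] may be infinite, the span is taken over a chosen maximal free list; [memv_colspan] and
    [colspan_sub] show that the choice does not matter. *)
Definition colspan D : {vspace vT} :=
  <<map col (projT1 (cid (maximal_free_seq D)))>>%VS.

Lemma colspan_free D : exists s : seq J,
  [/\ forall k, k \in s -> D k, free (map col s)
    & <<map col s>>%VS = colspan D].
Proof. by rewrite /colspan; case: cid => s [] /= *; exists s. Qed.

Lemma memv_colspan D k : D k -> col k \in colspan D.
Proof. by rewrite /colspan; case: cid => s [] /= _ _ + Dk; apply. Qed.

Lemma colspan_sub D U : (forall k, D k -> col k \in U) -> (colspan D <= U)%VS.
Proof.
move=> h; have [s [sD _ <-]] := colspan_free D.
by apply/span_subvP => _ /mapP[k /sD Dk ->]; exact: h.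
Qed.

Lemma colspanS D E : D `<=` E -> (colspan D <= colspan E)%VS.
Proof. by move=> DE; apply: colspan_sub => k /DE /memv_colspan. Qed.

Lemma colspanU D E : colspan (D `|` E) = (colspan D + colspan E)%VS.
Proof.
apply: subv_anti; apply/andP; split.
  apply: colspan_sub => k [] /memv_colspan; apply: subvP.
    exact: addvSl.
  exact: addvSr.
by rewrite subv_add; apply/andP; split; apply: colspanS => k; [left|right].
Qed.

Lemma colspan0 : colspan set0 = 0%VS.
Proof. by apply/eqP; rewrite -subv0; apply: colspan_sub => k []. Qed.

Lemma colspan_submodular D E :
  (\dim (colspan (D `|` E)) + \dim (colspan (D `&` E))
    <= \dim (colspan D) + \dim (colspan E))%N.
Proof.
rewrite colspanU -(dimv_sum_cap (colspan D)) leq_add2l dimvS// subv_cap.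
by rewrite !colspanS// => k [].
Qed.

Lemma colspan_seq s : colspan [set` s] = <<map col s>>%VS.
Proof.
apply: subv_anti; apply/andP; split.
  by apply: colspan_sub => k /= ks; rewrite memv_span// map_f.
by apply/span_subvP => _ /mapP[k ks ->]; exact: memv_colspan.
Qed.

Lemma free_dim_colspan s : free (map col s) = (\dim (colspan [set` s]) == size s).
Proof. by rewrite colspan_seq /free size_map. Qed.

Section Rado.
Variables (T : finType) (Y : T -> set J) (k0 : J).

Let YU (B : {set T}) : set J := [set k | exists2 r, r \in B & Y r k].

Let YU_setU (B C : {set T}) : YU (B :|: C) = YU B `|` YU C.
Proof.
apply/seteqP; split=> k.
  by move=> [r]; rewrite inE => /orP[] rB ?; [left|right]; exists r.
by move=> [] [r rB ?]; exists r => //; rewrite inE rB ?orbT.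
Qed.

(* The relative form over [U] is what makes the Halmos-Vaughan induction go
   through: the part already chosen is absorbed in [U]. *)
Lemma relative_linear_Rado U (D : {set T}) :
  (forall B : {set T}, B \subset D ->
    (#|B| + \dim U <= \dim (U + colspan (YU B)))%N) ->
  exists t : T -> J, (forall r, r \in D -> Y r (t r)) /\
    \dim (U + colspan [set t r | r in [set` D]])%VS = (#|D| + \dim U)%N.
Proof.
have [d] := ubnP #|D|; elim: d => // d IH in U D *; rewrite ltnS => Dd hD.
(* If a proper nonempty subfamily [B] meets its rank bound with equality, it is solved first. Its
   columns then fill [U + colspan (YU B)], and the condition for [C] in the complement relative to
   that space is the old condition for [C :|: B] with [#|B|] subtracted. *)
case: (pselect (exists B : {set T}, [/\ B \proper D, B != finset.set0 &
   \dim (U + colspan (YU B)) = (#|B| + \dim U)%N])) => [[B [BD B0 tB]]|nt].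
  have [|C CB|t1 [Yt1 dt1]] := IH U B.
  - exact: leq_trans (proper_card BD) Dd.
  - by apply: hD; exact: fintype.subset_trans CB (proper_sub BD).
  set U1 := (U + colspan [set t1 r | r in [set` B]])%VS in dt1.
  have U1E : U1 = (U + colspan (YU B))%VS.
    apply/eqP; rewrite eqEdim dt1 tB leqnn andbT addvS//.
    by apply: colspanS => _ [r rB <-]; exists r => //; exact: Yt1.
  have cDB : #|D :\: B| = (#|D| - #|B|)%N.
    by rewrite cardsD (finset.setIidPr (proper_sub BD)).
  have B_gt0 : (0 < #|B|)%N by rewrite card_gt0.
  have B_le := subset_leq_card (proper_sub BD).
  have [|C CD|t2 [Yt2 dt2]] := IH U1 (D :\: B).
  - by rewrite cDB; lia.
  - rewrite dt1 U1E -addvA -colspanU -YU_setU addnA.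
    have -> : (#|C| + #|B| = #|B :|: C|)%N.
      rewrite cardsU addnC; suff -> : B :&: C = finset.set0.
        by rewrite cards0 subn0.
      apply/setP => r; rewrite !inE; apply/negP => /andP[rB rC].
      by move/fintype.subsetP: CD => /(_ _ rC); rewrite !inE rB.
    apply: hD; rewrite finset.subUset (proper_sub BD).
    by apply: fintype.subset_trans CD _; exact: finset.subsetDl.
  exists (fun r => if r \in B then t1 r else t2 r); split.
    move=> r rD; case: ifPn => rB; first exact: Yt1.
    by apply: Yt2; rewrite inE rB.
  have -> : [set (if r \in B then t1 r else t2 r) | r in [set` D]] =
     [set t1 r | r in [set` B]] `|` [set t2 r | r in [set` (D :\: B)%SET]].
    apply/seteqP; split.
      move=> _ [r /= rD <-]; case: ifPn => rB; [left|right]; exists r => //=.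
      by rewrite inE rB.
    move=> _ [[r /= rB <-]|[r /= + <-]].
      by exists r => /=; [exact: (fintype.subsetP (proper_sub BD))|rewrite rB].
    by rewrite inE => /andP[/negbTE rB rD]; exists r => //; rewrite rB.
  by rewrite colspanU addvA -/U1 dt2 dt1 cDB; lia.
have [D0|/finset.set0Pn[r rD]] := eqVneq D finset.set0.
  exists (fun=> k0); rewrite D0; split; first by move=> r; rewrite inE.
  suff -> : [set k0 | _ in [set` (finset.set0 : {set T})]] = set0.
    by rewrite colspan0 addv0 cards0.
  by rewrite -subset0 => x [s /=]; rewrite inE.
(* With no tight proper subfamily, any column of [Y r] outside [U] may be chosen: it raises [\dim U]
   by one, and each proper nonempty subfamily has at least one unit of slack to absorb this. *)
have [k [Yk kU]] : exists k, Y r k /\ col k \notin U.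
  apply: contrapT => nk; have : [set r]%SET \subset D by rewrite finset.sub1set.
  move/hD; rewrite cards1; suff -> : (U + colspan (YU [set r]%SET))%VS = U.
    by rewrite ltnn.
  apply/addv_idPl/colspan_sub => k [s]; rewrite inE => /eqP -> Yk.
  by apply: contrapT => /negP kU; apply: nk; exists k.
set U1 := (U + <[col k]>)%VS.
have dU1 : \dim U1 = (\dim U).+1.
  rewrite dimv_disjoint_sum ?dim_vline; last first.
    apply/eqP; rewrite -subv0; apply/subvP => x /memv_capP[xU /vlineP[c xE]].
    rewrite memv0; move: xU; rewrite xE rpredZeq (negbTE kU) orbF => /eqP ->.
    by rewrite scale0r.
  by rewrite (_ : col k != 0) ?addn1//; apply: contraNneq kU => ->; rewrite mem0v.
have [||t2 [Yt2 dt2]] := IH U1 (D :\ r).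
- by rewrite (cardsD1 r D) rD in Dd.
- move=> B BD; have [->|B0] := eqVneq B finset.set0.
    by rewrite cards0 dimvS// addvSl.
  have Bp : B \proper D by apply: sub_proper_trans BD (properD1 rD).
  have := hD _ (proper_sub Bp); rewrite leq_eqVlt => /predU1P[tB|].
    by exfalso; apply: nt; exists B.
  rewrite dU1 addnS => /leq_trans; apply.
  by rewrite dimvS// addvS// addvSl.
exists (fun q => if q == r then k else t2 q); split.
  move=> s sD; case: eqVneq => [->//|sr]; apply: Yt2.
  by rewrite !inE sr.
have -> : [set (if q == r then k else t2 q) | q in [set` D]] =
   [set k] `|` [set t2 q | q in [set` (D :\ r)%SET]].
  apply/seteqP; split.
    move=> _ [s /= sD <-]; case: eqVneq => sr; [by left|right]; exists s => //=.
    by rewrite !inE sr.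
  move=> _ [->|[s /= + <-]]; first by exists r => //; rewrite eqxx.
  by rewrite !inE => /andP[/negbTE sr sD]; exists s => //; rewrite sr.
have -> : colspan ([set k] `|` [set t2 q | q in [set` (D :\ r)%SET]]) =
  (<[col k]> + colspan [set t2 q | q in [set` (D :\ r)%SET]])%VS.
  rewrite colspanU; congr (_ + _)%VS.
  have -> : [set k] = [set` [:: k]] by apply/seteqP; split=> x /=; rewrite inE => /eqP.
  by rewrite colspan_seq /= span_seq1.
by rewrite addvA -/U1 dt2 dU1 [in RHS](cardsD1 r D) rD; lia.
Qed.

End Rado.
End ColumnSpan.

(** * Base polytopes of submodular functions *)

Section BasePolytope.
Variables (m : nat) (f : {set 'I_m} -> nat).
Implicit Types (S T : {set 'I_m}) (i j : 'I_m).
Hypothesis f0 : f finset.set0 = 0%N.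
Hypothesis f_submod : forall S T, (f (S :|: T) + f (S :&: T) <= f S + f T)%N.

Definition setsum (D : nmodType) (a : 'rV[D]_m) S : D := \sum_(i in S) a ord0 i.

Definition base_poly (D : numDomainType) : set 'rV[D]_m :=
  [set a | setsum a [set: 'I_m]%SET = (f [set: 'I_m]%SET)%:R /\
           forall S, setsum a S <= (f S)%:R].

Definition tight (D : numDomainType) (a : 'rV[D]_m) S : bool :=
  setsum a S == (f S)%:R.

Lemma setsumT (D : nmodType) (a : 'rV[D]_m) :
  setsum a [set: 'I_m]%SET = \sum_i a ord0 i.
Proof. by apply: eq_bigl => i; rewrite inE. Qed.

Lemma setsumUI (D : nmodType) (a : 'rV[D]_m) S T :
  setsum a (S :|: T) + setsum a (S :&: T) = setsum a S + setsum a T.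
Proof.
rewrite /setsum (big_setID T (A := S :|: T)) (big_setID T (A := S)) /=.
rewrite finset.setIUl finset.setDUl finset.setDv finset.setU0 finset.setIid.
rewrite [in LHS](finset.setUidPr (finset.subsetIr _ _)).
by rewrite addrC (addrC (\sum_(i in T) _)) addrA.
Qed.

Section Tight.
Variables (D : realDomainType) (a : 'rV[D]_m).
Hypothesis aP : base_poly a.

(** Uncrossing: [setsum a] is modular and bounded by the submodular [f], so equality at [S] and [T]
    leaves no slack at the union or at the intersection. *)
Lemma tightUI S T : tight a S -> tight a T -> tight a (S :|: T) && tight a (S :&: T).
Proof.
move=> /eqP tS /eqP tT; have [_ le_a] := aP.
have := f_submod S T; rewrite -(ler_nat D) !natrD -tS -tT -setsumUI => h.
have hU := le_a (S :|: T); have hI := le_a (S :&: T).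
by rewrite /tight; apply/andP; split; apply/eqP; lra.
Qed.

Lemma tight0 : tight a finset.set0.
Proof. by rewrite /tight /setsum big_set0 f0. Qed.

Lemma tightT : tight a [set: 'I_m]%SET.
Proof. by apply/eqP; case: aP. Qed.

Lemma tight_bigcup (P : pred {set 'I_m}) :
  (forall S, P S -> tight a S) -> tight a (\bigcup_(S | P S) S)%SET.
Proof.
move=> tP; apply: (big_ind (tight a)) => //; first exact: tight0.
by move=> S T tS tT; case/andP: (tightUI tS tT).
Qed.

Lemma tight_bigcap (P : pred {set 'I_m}) :
  (forall S, P S -> tight a S) -> tight a (\bigcap_(S | P S) S)%SET.
Proof.
move=> tP; apply: (big_ind (tight a)) => //; first exact: tightT.
by move=> S T tS tT; case/andP: (tightUI tS tT).
Qed.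

End Tight.

Lemma setsum_shift (D : pzRingType) (a : 'rV[D]_m) (t : D) i j S :
  setsum (a + t *: (delta_mx ord0 i - delta_mx ord0 j)) S =
  setsum a S + t * ((i \in S)%:R - (j \in S)%:R).
Proof.
have sd k : \sum_(l in S) (delta_mx ord0 k : 'rV[D]_m) ord0 l = (k \in S)%:R.
  rewrite (eq_bigr (fun l => (l == k)%:R)); last by move=> l _; rewrite mxE eqxx.
  case: (boolP (k \in S)) => kS.
    by rewrite (bigD1 k)//= eqxx big1 ?addr0// => l /andP[_ /negbTE ->].
  by rewrite big1// => l lS; case: eqVneq => // lk; rewrite lk (negbTE kS) in lS.
rewrite /setsum -!sd -sumrB mulr_sumr -big_split /=.
by apply: eq_bigr => l _; rewrite !mxE.
Qed.

(** Moving [x] by [e_j - e_i] fails only if an [x]-tight set contains [j] and not [i]; moving [y] by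
    [e_i - e_j] fails only if a [y]-tight set contains [i] and not [j]. So [j] must avoid the
    largest [x]-tight set [Sx] without [i] and lie in the smallest [y]-tight set [Ty] with [i]. *)
Lemma base_poly_exchange (x y : 'rV[int]_m) i : base_poly x -> base_poly y ->
  y ord0 i < x ord0 i ->
  exists j, [/\ x ord0 j < y ord0 j,
                base_poly (x - delta_mx ord0 i + delta_mx ord0 j)
              & base_poly (y + delta_mx ord0 i - delta_mx ord0 j)].
Proof.
move=> xP yP yx.
pose Sx := (\bigcup_(S | tight x S && (i \notin S)) S)%SET.
pose Ty := (\bigcap_(S | tight y S && (i \in S)) S)%SET.
have tSx : tight x Sx by apply: tight_bigcup => // S /andP[].
have tTy : tight y Ty by apply: tight_bigcap => // S /andP[].
have iSx : i \notin Sx by apply/negP => /finset.bigcupP[S /andP[_ /negbTE ->]].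
have iTy : i \in Ty by apply/finset.bigcapP => S /andP[].
have [j [jT jS xyj]] : exists j, [/\ j \in Ty, j \notin Sx & x ord0 j < y ord0 j].
  (* Without such a [j], [y <= x] holds on [Ty :\: Sx], strictly at [i]. Then
     [x (Ty :|: Sx) + y (Ty :&: Sx)] exceeds [f Sx + f Ty], against submodularity. *)
  apply: contrapT => nj.
  have le_yx j : j \in Ty :\: Sx -> y ord0 j <= x ord0 j.
    rewrite inE => /andP[jS jT]; rewrite leNgt; apply/negP => h.
    by apply: nj; exists j.
  have lt_yx : setsum y (Ty :\: Sx) < setsum x (Ty :\: Sx).
    have iTS : i \in Ty :\: Sx by rewrite inE iSx.
    rewrite /setsum (bigD1 i)//= [ltRHS](bigD1 i)//= ltr_leD//.
    by apply: ler_sum => j /andP[/le_yx].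
  have [_ /(_ (Ty :|: Sx)) hx] := xP; have [_ /(_ (Ty :&: Sx)) hy] := yP.
  have := f_submod Ty Sx; rewrite -(ler_nat int) !natrD.
  move/eqP: tSx => <-; move/eqP: tTy => <-.
  have -> : setsum y Ty = setsum y (Ty :&: Sx) + setsum y (Ty :\: Sx).
    by rewrite /setsum (big_setID Sx).
  have : setsum x (Ty :|: Sx) = setsum x Sx + setsum x (Ty :\: Sx).
    rewrite /setsum (big_setID Sx) /= finset.setIUl finset.setIid.
    rewrite (finset.setUidPr (finset.subsetIr _ _)).
    by rewrite finset.setDUl finset.setDv finset.setU0.
  have arith (xU xS xd yI yd fU fI : int) : xU <= fU -> yI <= fI -> yd < xd ->
    xU = xS + xd -> fU + fI <= yI + yd + xS -> False by lia.
  exact: arith hx hy lt_yx.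
exists j; split=> //.
  rewrite -addrA [- _ + _]addrC -[_ - _]scale1r.
  split=> [|S]; rewrite setsum_shift mul1r.
    by rewrite !inE subrr addr0; case: xP.
  have [_ /(_ S) hx] := xP.
  have [jS'|jS'] := boolP (j \in S); have [iS|iS] := boolP (i \in S) => /=;
  rewrite ?(subrr, subr0, sub0r, addr0)//; last by rewrite (le_trans _ hx)// gerDl.
  (* Integrality enters here: a set that is not tight has slack at least one, enough for a unit
     move. *)
  rewrite lezD1 lt_neqAle hx andbT; apply: contra jS => tS.
  by apply/finset.bigcupP; exists S => //; rewrite iS andbT.
rewrite -addrA -[_ - _]scale1r.
split=> [|S]; rewrite setsum_shift mul1r.
  by rewrite !inE subrr addr0; case: yP.
have [_ /(_ S) hy] := yP.
have [jS'|jS'] := boolP (j \in S); have [iS|iS] := boolP (i \in S) => /=;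
  rewrite ?(subrr, subr0, sub0r, addr0)//; first by rewrite (le_trans _ hy)// gerDl.
rewrite lezD1 lt_neqAle hy andbT; apply: contra jS' => tS.
by move/finset.bigcapP: jT; apply; rewrite iS andbT.
Qed.

(** * Integrality of the base polytope *)

Section Integrality.
Variable R : realType.
Implicit Type a : 'rV[R]_m.

(** The step length is the least slack among the sets containing [i] but not [j], the only sets
    whose sum grows. A minimizing set becomes tight, while every set already tight contains both
    indices or neither and stays tight. *)
Lemma base_poly_push a i j : base_poly a ->
  (forall S, tight a S -> i \in S -> j \in S) -> i != j ->
  (forall S, tight a S -> j \in S -> i \in S) ->
  exists2 t : R, 0 < t & let a' := a + t *: (delta_mx ord0 i - delta_mx ord0 j) in
    base_poly a' /\ (#|[set S | ~~ tight a' S]%SET| < #|[set S | ~~ tight a S]%SET|)%N.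
Proof.
move=> aP hij ij hji; pose P S := (i \in S) && (j \notin S).
pose slack S := (f S)%:R - setsum a S.
have Pi : P [set i]%SET by rewrite /P !inE eqxx eq_sym.
have [S0 /andP[iS0 jS0] min] := @arg_minP _ R _ [set i]%SET P slack Pi.
have ntS0 : ~~ tight a S0 by apply: contra jS0 => /hij; apply.
have [_ le_a] := aP.
have s0 : 0 < slack S0.
  by rewrite subr_gt0 lt_neqAle le_a andbT.
exists (slack S0) => //=; set a' := a + _.
have a'E S : setsum a' S = setsum a S + slack S0 * ((i \in S)%:R - (j \in S)%:R).
  exact: setsum_shift.
split.
  split=> [|S]; rewrite a'E.
    by rewrite !inE subrr mulr0 addr0; case: aP.
  have := le_a S; have := min S; rewrite /P.
  case: (i \in S); case: (j \in S) => //=; rewrite ?subrr ?mulr0 ?addr0//.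
    by rewrite subr0 mulr1 => /(_ isT); rewrite {2}/slack => h _; lra.
  by rewrite sub0r mulrN1 => _ h; lra.
apply: proper_card; apply/properP; split.
  apply/fintype.subsetP => S; rewrite !inE; apply: contra => tS.
  rewrite /tight a'E (eqP tS).
  have -> : (j \in S) = (i \in S) by apply/idP/idP; [exact: hji|exact: hij].
  by rewrite subrr mulr0 addr0.
exists S0; rewrite inE// negbK /tight a'E iS0 (negbTE jS0) subr0 mulr1.
by rewrite addrC subrK.
Qed.

(** Induction on the number of sets that are not tight: a nonintegral point is a convex combination
    of two points of the polytope with more tight sets. *)
Lemma base_poly_integral (C : set 'rV[R]_m) :
  @convex_set R 'rV[R]_m C ->
  (forall z : 'rV[int]_m, base_poly (toR R z) -> C (toR R z)) ->
  @base_poly R `<=` C.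
Proof.
move=> Cconv Cz a aP.
have [d] := ubnP #|[set S | ~~ tight a S]%SET|.
elim: d => // d IH in a aP *; rewrite ltnS => ad.
pose frac i := a ord0 i \isn't a Num.int.
have [/existsP[i0 fi0]|] := boolP [exists i, frac i]; last first.
  rewrite negb_exists => /forallP ai.
  have aE : a = toR R (\row_i Num.floor (a ord0 i)).
    apply/rowP => i; rewrite !mxE; apply/esym/eqP; rewrite -intrEfloor.
    by have := ai i; rewrite negbK.
  by rewrite aE; apply: Cz; rewrite -aE.
pose P S := tight a S && [exists i in S, frac i].
have PT : P [set: 'I_m]%SET.
  by rewrite /P tightT//=; apply/existsP; exists i0; rewrite inE.
have [T /andP[tT /existsP[i /andP[iT fi]]] minT] := arg_minnP (fun S => #|S|) PT.
(* The sum over the tight set [T] is the integer [f T], so one fractional coordinate cannot be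
   alone. As [T] has least cardinality among the tight sets with a fractional coordinate, a tight
   set containing one fractional element of [T] contains all of [T]; hence [i] and [j] lie in the
   same tight sets. *)
have [j [jT ji fj]] : exists j, [/\ j \in T, j != i & frac j].
  apply: contrapT => nj; move/negP: fi; apply.
  have -> : a ord0 i = setsum a T - \sum_(k in T | k != i) a ord0 k.
    by rewrite /setsum (bigD1 i)//= addrK.
  rewrite (eqP tT) rpredB ?rpred_nat// rpred_sum// => k /andP[kT ki].
  by apply: contrapT => /negP fk; apply: nj; exists k.
have min_swap k l S : k \in T -> l \in T -> frac k -> tight a S -> k \in S -> l \in S.
  move=> kT lT fk tS kS; have /andP[_ tI] := tightUI aP tS tT.
  have : P (S :&: T).
    by rewrite /P tI; apply/existsP; exists k; rewrite inE kS kT.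
  move/minT => cT; suff /eqP/finset.setIidPr TS : S :&: T == T.
    by apply: (fintype.subsetP TS).
  by rewrite eqEcard finset.subsetIr.
have ij : i != j by rewrite eq_sym.
have hij S := @min_swap i j S iT jT fi; have hji S := @min_swap j i S jT iT fj.
have [t t0 [tP td]] := base_poly_push aP hij ij hji.
have [u u0 [uP ud]] := base_poly_push aP hji ji hij.
have Ct := IH _ tP (leq_trans td ad); have Cu := IH _ uP (leq_trans ud ad).
have tu0 : 0 < t + u by rewrite addr_gt0.
(* The pushes by [t] along [e_i - e_j] and by [u] along its opposite cancel with weights
   [u / (t + u)] and [t / (t + u)]. *)
have l0 : 0 <= u / (t + u) by rewrite divr_ge0// ltW.
have l1 : u / (t + u) <= 1 by rewrite ler_pdivrMr// mul1r lerDr ltW.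
have := Cconv _ _ (Itv01 l0 l1) (mem_set Ct) (mem_set Cu).
rewrite inE; congr C; apply/rowP => k; rewrite /conv/= !mxE.
move: (_ == i)%:R (_ == j)%:R => ? ?.
by rewrite /unstable.onem; field; rewrite gt_eqF.
Qed.

End Integrality.
End BasePolytope.

(** * Ranks of projections *)

Section Dimension.
Variables (K : fieldType) (E : lmodType K).
Implicit Type V : set E.

Lemma has_dim_le V a b : has_dim V a -> has_dim V b -> (a <= b)%N.
Proof.
move=> [v [v_ind v_span]] [w [w_ind w_span]].
have /choice[c cE] : forall r, exists c : 'I_b -> K, v r = \sum_s c s *: w s.
  move=> r; suff : lin_span w (v r) by [].
  rewrite w_span -v_span; exists (fun q => (q == r)%:R).
  rewrite (bigD1 r)//= eqxx scale1r big1 ?addr0// => q /negbTE ->.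
  by rewrite scale0r.
pose M : 'M[K]_(a, b) := \matrix_(r, s) c r s.
suff /eqP rM : row_free M by rewrite -rM rank_leq_col.
apply: inj_row_free => u uM; apply/rowP => r; rewrite mxE.
apply: v_ind (fun r => u ord0 r) _ r.
transitivity (\sum_s (u *m M) ord0 s *: w s).
  under [RHS]eq_bigr do rewrite mxE scaler_suml.
  rewrite exchange_big/=; apply: eq_bigr => r _.
  rewrite cE scaler_sumr; apply: eq_bigr => s _.
  by rewrite scalerA !mxE.
by rewrite uM big1// => s _; rewrite mxE scale0r.
Qed.

Lemma subspace_dimE V a : has_dim V a -> subspace_dim V = a.
Proof.
move=> Va; rewrite /subspace_dim; case: xgetP => [b -> Vb|/(_ a)//].
by apply/eqP; rewrite eqn_leq !(@has_dim_le V).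
Qed.

End Dimension.

Lemma vect_sumE (R : realType) m n (F : 'I_n -> vect R m) k :
  (\sum_r F r) k = \sum_r F r k.
Proof. by elim/big_rec2: _ => // r x y _ <-. Qed.

Lemma vect_combE (R : realType) m n (c : 'I_n -> R[i]) (F : 'I_n -> vect R m) k :
  (\sum_r c r *: F r) k = \sum_r c r * F r k.
Proof. by rewrite vect_sumE. Qed.

Section ProjectionRank.
Variables (R : realType) (m n : nat) (v : 'I_n -> vect R m).
Local Notation C := R[i].
Local Notation col := (column v).

Definition color_class (S : {set 'I_m}) : set (idx m) := [set k | color k \in S].

Definition proj_rank (S : {set 'I_m}) : nat := \dim (colspan col (color_class S)).

Definition comb (c : 'rV[C]_n) : vect R m := \sum_r c ord0 r *: v r.

Lemma combE c k : comb c k = (c *m col k) ord0 ord0.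
Proof. by rewrite /comb vect_combE mxE; apply: eq_bigr => r _; rewrite mxE. Qed.

Lemma comb_span : lin_span v = range comb.
Proof.
apply/seteqP; split=> x [c].
  move=> ->; exists (\row_r c r) => //.
  by apply: eq_bigr => r _; rewrite mxE.
by move=> _ <-; exists (fun r => c ord0 r).
Qed.

Lemma comb_linear a c c' : comb (a *: c + c') = a *: comb c + comb c'.
Proof.
rewrite /comb scaler_sumr -big_split/=; apply: eq_bigr => r _.
by rewrite !mxE scalerDl scalerA.
Qed.

Lemma comb_sum d (a : 'I_d -> C) (c : 'I_d -> 'rV[C]_n) :
  comb (\sum_b a b *: c b) = \sum_b a b *: comb (c b).
Proof.
elim/big_rec2: _ => [|b x y _ <-]; last by rewrite comb_linear.
by rewrite /comb big1// => r _; rewrite mxE scale0r.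
Qed.

(* The columns of [M] form a basis of the span of all columns in [D]. *)
Lemma column_basis D : exists d (M : 'M[C]_(n, d)) (s : 'I_d -> idx m),
  [/\ d = \dim (colspan col D), row_free M^T, forall a, D (s a),
      forall c a, (c *m M) ord0 a = comb c (s a)
    & forall c, c *m M = 0 -> forall k, D k -> comb c k = 0].
Proof.
have [s [sD fs sE]] := colspan_free col D.
pose X := in_tuple (map col s).
pose M : 'M[C]_(n, size (map col s)) := \matrix_(r, a) (X`_a) r ord0.
have szE : size (map col s) = size s by rewrite size_map.
pose k0 a := tnth (in_tuple s) (cast_ord szE a).
have XE (a : 'I_(size (map col s))) : X`_a = col (k0 a).
  have as_ : (a < size s)%N by rewrite -szE.
  by rewrite /k0 (tnth_nth (k0 a)) /= (nth_map (k0 a)).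
have ME c a : (c *m M) ord0 a = comb c (k0 a).
  rewrite combE !mxE; apply: eq_bigr => r _; by rewrite mxE XE.
exists (size (map col s)), M, k0; split.
- by rewrite -sE; apply/esym/eqP.
- apply: inj_row_free => u uM; apply/rowP => a; rewrite mxE.
  have /freeP/(_ (fun a => u ord0 a)) : free X by []; apply.
  apply/colP => r; rewrite summxE mxE.
  transitivity ((u *m M^T) ord0 r); last by rewrite uM mxE.
  by rewrite mxE; apply: eq_bigr => b _; rewrite !mxE.
- by move=> a; apply: sD; exact: mem_tnth.
- exact: ME.
- move=> c cM k Dk; rewrite combE.
  have : col k \in <<X>>%VS by rewrite /= sE memv_colspan.
  move/coord_span => ->; rewrite mulmx_sumr summxE big1// => a _.
  by rewrite -scalemxAr mxE XE -combE -ME cM mxE mulr0.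
Qed.

Variable V : set (vect R m).
Hypothesis hv : is_basis v V.

Lemma comb_inj c : comb c = 0 -> c = 0.
Proof.
move=> c0; apply/rowP => r; rewrite mxE; case: hv => v_ind _.
exact: v_ind (fun r => c ord0 r) c0 r.
Qed.

Lemma basis_range : V = range comb.
Proof. by rewrite -comb_span; case: hv. Qed.

(** Row rank equals column rank. A right inverse of [M^T] supplies combinations [comb (c b)] dual to
    evaluation at the points [s a], and those evaluations determine a vector of [V] on all of
    [color_class S]. *)
Lemma has_dim_proj S : has_dim (summand_proj S @` V) (proj_rank S).
Proof.
have [d [M [s [dE frM sS ME Mz]]]] := column_basis (color_class S).
rewrite /proj_rank -dE.
have [B MB] := row_freeP frM.
pose c b : 'rV[C]_n := \row_r B r b.
have cE b a : comb (c b) (s a) = (a == b)%:R.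
  rewrite -ME; have := congr1 (fun A : 'M[C]_d => A a b) MB; rewrite !mxE => <-.
  by apply: eq_bigr => r _; rewrite !mxE mulrC.
have projE x a : summand_proj S x (s a) = x (s a).
  by rewrite /summand_proj; have := sS a; rewrite /color_class/= => ->.
have proj_sum (e : 'I_d -> C) :
    \sum_b e b *: summand_proj S (comb (c b)) =
    summand_proj S (comb (\sum_b e b *: c b)).
  apply/funext => k; rewrite vect_combE comb_sum /summand_proj vect_combE.
  by case: ifPn => // _; rewrite big1// => b _; rewrite mulr0.
exists (fun b => summand_proj S (comb (c b))); split.
  move=> e e0 a; have := congr1 (fun x : vect R m => x (s a)) e0.
  rewrite proj_sum projE comb_sum vect_combE (bigD1 a)//= big1; last first.
    by move=> b ba; rewrite cE eq_sym (negbTE ba) mulr0.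
  by rewrite cE eqxx mulr1 addr0.
apply/seteqP; split=> x.
  move=> [e ->]; rewrite proj_sum; exists (comb (\sum_b e b *: c b)) => //.
  by rewrite basis_range; exists (\sum_b e b *: c b).
move=> [y]; rewrite basis_range => -[g _ <-] <-.
exists (fun b => comb g (s b)); rewrite proj_sum.
apply/funext => k; rewrite /summand_proj; case: ifPn => // kS.
apply/eqP; rewrite -subr_eq0; apply/eqP.
transitivity (comb (- 1 *: (\sum_b comb g (s b) *: c b) + g) k).
  by rewrite comb_linear scaleN1r addrC.
apply: Mz => //; apply/rowP => a; rewrite ME mxE.
rewrite comb_linear scaleN1r.
change (- comb (\sum_b comb g (s b) *: c b) (s a) + comb g (s a) = 0).
rewrite comb_sum vect_combE (bigD1 a)//= big1 ?addr0; last first.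
  by move=> b ba; rewrite cE eq_sym (negbTE ba) mulr0.
by rewrite cE eqxx mulr1 addNr.
Qed.

(** Lying in the summands of [T] means that the coefficient row annihilates all columns of the other
    colors, so the intersection is the kernel of the matrix of a column basis for [~: T]. *)
Lemma has_dim_inter (p : 'I_m -> R) T : V `<=` sum_ell p ->
  has_dim (V `&` sub_sum p T) (n - proj_rank (~: T)).
Proof.
move=> Vp.
have [d [M [s [dE frM sS ME Mz]]]] := column_basis (color_class (~: T)).
have -> : (n - proj_rank (~: T))%N = \rank (kermx M).
  by rewrite mxrank_ker /proj_rank -dE -mxrank_tr (eqP frM).
pose c a := row a (row_base (kermx M)).
have cM a : c a *m M = 0.
  apply/sub_kermxP; rewrite (submx_trans (row_sub _ _))//.
  by rewrite eq_row_base.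
exists (fun a => comb (c a)); split.
  move=> e; rewrite -comb_sum => /comb_inj e0 a.
  have : (\row_a e a) *m row_base (kermx M) = 0.
    by rewrite mulmx_sum_row -[RHS]e0; apply: eq_bigr => b _; rewrite mxE.
  have /row_free_inj inj := row_base_free (kermx M).
  rewrite -(mul0mx _ (row_base (kermx M))) => /inj /rowP /(_ a).
  by rewrite !mxE.
apply/seteqP; split=> x.
  move=> [e ->]; rewrite -comb_sum.
  have Vx : V (comb (\sum_a e a *: c a)).
    by rewrite basis_range; exists (\sum_a e a *: c a).
  split=> //; split; first exact: Vp.
  move=> k kT; apply: Mz; last by rewrite /color_class/= inE.
  rewrite mulmx_suml big1// => a _.
  by rewrite -scalemxAl cM scaler0.
move=> [Vx [_ x0]]; move: Vx x0; rewrite {1}basis_range => -[g _ <-] x0.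
have /sub_kermxP gM : g *m M = 0.
  apply/rowP => a; rewrite ME mxE; apply: x0.
  by have := sS a; rewrite /color_class/= inE.
have /submxP[e ge] : (g <= row_base (kermx M))%MS by rewrite eq_row_base.
exists (fun a => e ord0 a); rewrite -comb_sum ge mulmx_sum_row.
by [].
Qed.

Lemma proj_rank_full : proj_rank [set: 'I_m] = n.
Proof.
have := has_dim_proj [set: 'I_m]%SET.
suff -> : summand_proj [set: 'I_m]%SET @` V = V.
  have : has_dim V n by exists v.
  move=> h1 h2; rewrite -(subspace_dimE h1); exact: esym (subspace_dimE h2).
apply/seteqP; split=> [_ [x Vx <-]|x Vx]; last exists x => //.
all: suff -> : summand_proj [set: 'I_m]%SET x = x by [].
all: by apply/funext => k; rewrite /summand_proj inE.
Qed.

Lemma proj_rank0 : proj_rank finset.set0 = 0%N.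
Proof.
rewrite /proj_rank (_ : color_class _ = set0) ?colspan0 ?dimv0//.
by rewrite -subset0 => k; rewrite /color_class/= inE.
Qed.

Lemma proj_rank_submod S T :
  (proj_rank (S :|: T) + proj_rank (S :&: T) <= proj_rank S + proj_rank T)%N.
Proof.
rewrite /proj_rank.
have -> : color_class (S :|: T) = color_class S `|` color_class T.
  by apply/seteqP; split=> k; rewrite /color_class/= inE => /orP.
have -> : color_class (S :&: T) = color_class S `&` color_class T.
  by apply/seteqP; split=> k; rewrite /color_class/= inE => /andP.
exact: colspan_submodular.
Qed.

Lemma proj_rank_le S : (proj_rank S <= n)%N.
Proof.
rewrite -proj_rank_full; apply/dimvS/colspanS => k _.
by rewrite /color_class/= inE.
Qed.

(** Nonnegativity is automatic in the base polytope: the coordinates other than [i] sum to at most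
    [n], the total is [n], so [a_i >= 0]. *)
Lemma polytopeE : polytope n V = @base_poly m proj_rank R.
Proof.
apply/seteqP; split=> a.
  move=> [a0 an aS]; split; first by rewrite setsumT proj_rank_full.
  by move=> S; have := aS S; rewrite (subspace_dimE (has_dim_proj S)).
move=> [aT aS]; have an : \sum_i a ord0 i = n%:R.
  by rewrite -[in RHS]proj_rank_full -aT setsumT.
split=> //; last by move=> S; rewrite (subspace_dimE (has_dim_proj S)); exact: aS.
move=> i; have : setsum a [set~ i]%SET <= n%:R.
  by apply: le_trans (aS _) _; rewrite ler_nat; exact: proj_rank_le.
rewrite /setsum -an [leRHS](bigD1 i)//= [leLHS](eq_bigl (fun j => j != i)); last first.
  by move=> j; rewrite !inE.
by rewrite lerDr.
Qed.

(** Complementation exchanges the two systems: both the coordinate sums and the two dimensions at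
    [S] and [~: S] add up to [n]. *)
Lemma polytope_lowerE (p : 'I_m -> R) : V `<=` sum_ell p ->
  polytope_lower n p V = polytope n V.
Proof.
move=> Vp.
have compl (a : 'rV[R]_m) S : \sum_i a ord0 i = n%:R ->
    \sum_(i in ~: S) a ord0 i = n%:R - \sum_(i in S) a ord0 i.
  move=> <-; rewrite [in RHS](bigID (mem S)) /= addrAC subrr add0r.
  by apply: eq_bigl => i; rewrite inE.
apply/seteqP; split=> a [a0 an aS]; split=> // S.
  have := aS (~: S); rewrite (subspace_dimE (has_dim_inter _ Vp)).
  rewrite (subspace_dimE (has_dim_proj _)) finset.setCK natrB ?proj_rank_le//.
  by rewrite compl// lerD2l lerN2.
have := aS (~: S); rewrite (subspace_dimE (has_dim_inter _ Vp)).
rewrite (subspace_dimE (has_dim_proj _)) natrB ?proj_rank_le//.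
by rewrite compl//; move: (\sum_(i in S) _) => ?; lra.
Qed.

End ProjectionRank.

(** * Plücker support and the colored column matroid *)

Section ConvexBasePolytope.
Variables (R : realType) (m : nat) (f : {set 'I_m} -> nat).

Lemma setsum_toR (a : 'rV[int]_m) S : setsum (toR R a) S = (setsum a S)%:~R.
Proof. by rewrite /setsum rmorph_sum; apply: eq_bigr => i _; rewrite mxE. Qed.

Lemma base_poly_toR (a : 'rV[int]_m) :
  base_poly f (toR R a) <-> base_poly f a.
Proof.
have nE k : k%:R = (k%:R : int)%:~R :> R by rewrite rmorph_nat.
split=> -[aT aS]; split.
- by apply/eqP; rewrite -(eqr_int R) -setsum_toR aT -nE.
- by move=> S; rewrite -(ler_int R) -setsum_toR -nE.
- by rewrite setsum_toR aT -nE.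
- by move=> S; rewrite setsum_toR nE ler_int.
Qed.

Lemma base_poly_convex : @convex_set R 'rV[R]_m (@base_poly m f R).
Proof.
move=> x y l; rewrite !inE => -[xT xS] [yT yS].
have l0 : 0 <= l%:num by []. have l1 : l%:num <= 1 by [].
have sE S : setsum (conv l x y : 'rV[R]_m) S =
    l%:num * setsum x S + (1 - l%:num) * setsum y S.
  rewrite /setsum !mulr_sumr -big_split; apply: eq_bigr => i _.
  by rewrite /conv/= !mxE.
split; first by rewrite sE xT yT; ring.
move=> S; rewrite sE [leRHS](_ : _ = l%:num * (f S)%:R + (1 - l%:num) * (f S)%:R).
  by rewrite lerD// ler_wpM2l// subr_ge0.
by ring.
Qed.

End ConvexBasePolytope.

(** Turns a composition into a Rado family of [n] members in which the class of color [i] is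
    repeated [a_i] times. *)
Lemma exists_coloring m n (a : 'rV[int]_m) :
  (forall i, 0 <= a ord0 i) -> \sum_i a ord0 i = n%:Z ->
  exists c : 'I_n -> 'I_m, forall i, a ord0 i = #|[set r | c r == i]%SET|%:Z.
Proof.
move=> a0 an.
pose s := flatten [seq nseq `|a ord0 i|%N i | i <- enum 'I_m].
have cs i : count_mem i s = `|a ord0 i|%N.
  rewrite count_flatten -map_comp sumnE big_map big_enum/= (bigD1 i)//=.
  rewrite count_nseq /= eqxx mul1n big1 ?addn0// => j /negbTE ji.
  by rewrite count_nseq /= ji.
have szs : size s == n.
  rewrite size_flatten /shape -map_comp sumnE big_map big_enum/= -eqz_nat -an.
  rewrite -[X in X == _]natz natr_sum; apply/eqP/eq_bigr => i _.
  by rewrite size_nseq natz gez0_abs.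
exists (tnth (Tuple szs)) => i; rewrite -[LHS]gez0_abs// -cs; congr (Posz _).
rewrite cardsE cardE /enum_mem size_filter.
have sE : map (tnth (Tuple szs)) (enum 'I_n) = s by rewrite map_tnth_enum.
by rewrite -[in LHS]sE count_map enumT.
Qed.

Lemma perm_fset_image n (J : choiceType) (t : 'I_n -> J) : injective t ->
  perm_eq [fset t r | r in 'I_n]%fset (map t (enum 'I_n)).
Proof.
move=> t_inj; apply: uniq_perm; first exact: fset_uniq.
  by rewrite (map_inj_uniq t_inj); exact: enum_uniq.
by move=> k; apply/imfsetP/mapP => -[r _ ->]; exists r; rewrite ?mem_enum.
Qed.

Section ColumnMatroid.
Variables (R : realType) (m n : nat) (v : 'I_n -> vect R m) (V : set (vect R m)).
Hypotheses (hm : (1 <= m)%N) (hv : is_basis v V).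
Local Notation C := R[i].
Local Notation A := (idx m).
Local Notation col := (column v).
Local Notation f := (proj_rank v).

Lemma plucker_neq0 (I : n.-tuple A) : (plucker v I != 0) = free (map col I).
Proof.
rewrite /plucker -unitfE -[_ \is a GRing.unit]/(_ \in unitmx) -unitmx_tr.
set M := (X in X^T).
have ME u : (u *m M^T)^T = \sum_s u ord0 s *: (map col I)`_s :> 'cV[C]_n.
  apply/colP => r; rewrite summxE !mxE; apply: eq_bigr => s _; rewrite !mxE.
  have sI : (s < size I)%N by rewrite size_tuple.
  by rewrite (nth_map (tnth I s)) // -tnth_nth mxE.
have -> : free (map col I) = free [tuple of map col I] by [].
rewrite -row_free_unit; apply/idP/freeP => [/row_free_inj inj k k0 r|h].
  have : (\row_r k r) *m M^T = 0 *m M^T.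
    rewrite mul0mx; apply: trmx_inj; rewrite ME trmx0 -[RHS]k0.
    by apply: eq_bigr => s _; rewrite mxE.
  by move/inj/rowP/(_ r); rewrite !mxE.
apply: inj_row_free => u uM; apply/rowP => r; rewrite mxE.
by apply: (h (fun r => u ord0 r)); rewrite -ME uM trmx0.
Qed.

Lemma setsum_color_count (s : seq A) (S : {set 'I_m}) :
  setsum (color_count s) S = (count (fun k => color k \in S) s)%:Z.
Proof.
rewrite /setsum; elim: s => [|k s IH] /=.
  by rewrite big1// => i _; rewrite mxE.
rewrite PoszD -IH.
have -> : ((color k \in S) : nat)%:Z = \sum_(i in S) (color k == i)%:R.
  have [kS|kS] := boolP (color k \in S).
    rewrite (bigD1 (color k))//= eqxx big1 ?addr0// => i /andP[_].
    by rewrite eq_sym => /negbTE ->.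
  by rewrite big1// => i iS; case: eqVneq => // ki; rewrite ki iS in kS.
rewrite -big_split/=; apply: eq_bigr => i _; rewrite !mxE /= PoszD.
by case: (_ == _).
Qed.

(** Freeness and color counts do not depend on the order, so the increasing enumeration required by
    [nsubsets] is recovered by sorting. *)
Lemma supportP a : plucker_support v a <->
  exists s : seq A, [/\ size s = n, free (map col s) & color_count s = a].
Proof.
split=> [[_ [I [_ Ia] pI]]|[s [sn fs <-]]].
  by exists I; rewrite size_tuple -plucker_neq0.
have perm_s : perm_eq (sort <=%O s) s by rewrite perm_sort.
have szs : size (sort <=%O s) == n by rewrite size_sort sn.
have us : uniq s by apply: (map_uniq (f := col)); exact: free_uniq fs.
split.
  split=> [i|]; first by rewrite mxE.
  rewrite -setsumT setsum_color_count -sn; congr (Posz _).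
  by rewrite (eq_count (a2 := xpredT)) ?count_predT// => k; rewrite inE.
exists (Tuple szs); last first.
  by rewrite plucker_neq0 (perm_free (perm_map col perm_s)).
split; first by rewrite /nsubsets/= sort_lt_sorted.
by apply/rowP => i; rewrite !mxE (seq.permP perm_s).
Qed.

Lemma free_size_le (s : seq A) D : free (map col s) ->
  (forall k, k \in s -> D k) -> (size s <= \dim (colspan col D))%N.
Proof.
move=> fs sD; have := fs; rewrite free_dim_colspan => /eqP <-.
by apply/dimvS/colspanS => k; exact: sD.
Qed.

Lemma free_size_le_n (s : seq A) : free (map col s) -> (size s <= n)%N.
Proof.
move=> fs; rewrite -[leqRHS](proj_rank_full hv); apply: free_size_le => // k _.
by rewrite /color_class/= inE.
Qed.

Lemma support_base_poly a : plucker_support v a -> base_poly f a.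
Proof.
move=> /supportP[s [sn fs <-]]; split=> [|S]; rewrite setsum_color_count.
  rewrite (proj_rank_full hv) natz -sn; congr (Posz _).
  by rewrite (eq_count (a2 := xpredT)) ?count_predT// => k; rewrite inE.
rewrite natz lez_nat -size_filter; apply: free_size_le.
  apply: (@catl_free _ _ (map col [seq k <- s | color k \notin S])).
  by rewrite -map_cat (perm_free (perm_map col (permEl (perm_filterC _ s)))).
by move=> k; rewrite mem_filter => /andP[].
Qed.

Lemma le_col_rankP r Y : le_col_rank v r Y <-> (r <= \dim (colspan col Y))%N.
Proof.
split=> [[J [fJ JY rJ]]|rY].
  by apply: leq_trans rJ _; exact: free_size_le.
have [s [sY fs sE]] := colspan_free col Y.
have us : uniq s by apply: (map_uniq (f := col)); exact: free_uniq fs.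
have pJ : perm_eq [fset k in s]%fset s.
  by apply: uniq_perm => // k; rewrite inE.
exists [fset k in s]%fset; split.
- by rewrite /col_indep (perm_free (perm_map col pJ)).
- by move=> k /=; rewrite inE; exact: sY.
- by rewrite (perm_size pJ); move: rY; rewrite -sE (eqP fs) size_map.
Qed.

Section Coloring.
Variables (a : 'rV[int]_m) (c : 'I_n -> 'I_m).
Hypothesis ac : forall i, a ord0 i = #|[set r | c r == i]%SET|%:Z.

Lemma setsum_coloring S : setsum a S = #|[set r | c r \in S]%SET|%:Z.
Proof.
rewrite /setsum; under eq_bigr do rewrite ac.
have cE (P : pred 'I_n) : #|[set r | P r]%SET|%:Z = \sum_r (P r)%:R :> int.
  rewrite cardsE -sum1_card big_mkcond /= -natz natr_sum.
  by apply: eq_bigr => r _; rewrite unfold_in; case: (P r).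
under eq_bigr do rewrite cE.
rewrite cE exchange_big/=; apply: eq_bigr => r _.
have [rS|rS] := boolP (c r \in S).
  rewrite (bigD1 (c r))//= eqxx big1 ?addr0// => i /andP[_].
  by rewrite eq_sym => /negbTE ->.
by rewrite big1// => i iS; case: eqVneq => // ki; rewrite ki iS in rS.
Qed.

(** The union of the classes met by [J] is the color class of [S = c(J)], and [#|J| <= a(S) <= f S]:
    Rado's conditions reduce to unions of whole colors. *)
Lemma base_poly_Rado : base_poly f a -> Rado_condition v c.
Proof.
move=> [_ aS] J; apply/le_col_rankP; pose S := [set c r | r in J]%SET.
have -> : [set k : A | exists2 r, r \in J & color k = c r] = color_class S.
  apply/seteqP; split=> k.
    by move=> [r rJ kE]; rewrite /color_class/= kE; exact: imset_f.
  by move/imsetP => [r rJ kE]; exists r.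
have := aS S; rewrite setsum_coloring natz lez_nat; apply: leq_trans.
apply/subset_leq_card/fintype.subsetP => r rJ; rewrite inE; exact: imset_f.
Qed.

Lemma transversal_support : indep_transversal v c -> plucker_support v a.
Proof.
move=> [t [t_inj tc ft]]; apply/supportP.
have pt := perm_fset_image t_inj.
exists (map t (enum 'I_n)); split.
- by rewrite size_map size_enum_ord.
- by rewrite -(perm_free (perm_map col pt)).
- apply/rowP => i; rewrite mxE ac count_map; congr (Posz _).
  rewrite cardsE cardE [in RHS]/enum_mem size_filter -enumT; apply: eq_count => r.
  by rewrite /= tc.
Qed.

End Coloring.

Lemma Rado_transversal c : Rado_condition v c -> indep_transversal v c.
Proof.
move=> hc; pose Y r : set A := [set k | color k = c r].
(* A default value for the transversal outside the subfamily under consideration; such an index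
   exists since [m >= 1]. *)
have k0 : A := (Ordinal hm, 0%N).
have [|t [tY dt]] := @relative_linear_Rado _ _ _ col _ Y k0 0%VS [set: 'I_n]%SET.
  by move=> B _; rewrite dimv0 addn0 add0v; exact/le_col_rankP/hc.
rewrite add0v dimv0 addn0 cardsT card_ord in dt.
have fs : free (map col (map t (enum 'I_n))).
  rewrite free_dim_colspan size_map size_enum_ord; apply/eqP; rewrite -[RHS]dt.
  congr (\dim (colspan _ _)); apply/seteqP; split=> k.
    by move=> /mapP[r _ ->]; exists r; rewrite //= inE.
  by move=> [r _ <-] /=; rewrite map_f ?mem_enum.
(* Rado's lemma only gives the rank of the chosen set; rank [n] from [n] choices makes the columns
   free, hence the choices distinct. *)
have ut : uniq (map t (enum 'I_n)) by apply: (map_uniq (f := col)); exact: free_uniq.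
have t_inj : injective t by apply/injectiveP.
exists t; split=> // [r|]; first by apply: tY; rewrite inE.
have pt := perm_fset_image t_inj.
by rewrite /col_indep (perm_free (perm_map col pt)).
Qed.

End ColumnMatroid.

Section Support.
Variables (R : realType) (m n : nat) (v : 'I_n -> vect R m) (V : set (vect R m)).
Hypotheses (hm : (1 <= m)%N) (hv : is_basis v V).
Local Notation A := (idx m).
Local Notation col := (column v).
Local Notation f := (proj_rank v).

Lemma base_poly_ge0 (a : 'rV[int]_m) : base_poly f a ->
  (forall i, 0 <= a ord0 i) /\ \sum_i a ord0 i = n%:Z.
Proof.
move=> aP; have := aP => /(base_poly_toR R); rewrite -(polytopeE hv) => -[a0 _ _].
split=> [i|]; first by have := a0 i; rewrite mxE ler0z.
by case: aP => + _; rewrite setsumT (proj_rank_full hv) natz.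
Qed.

Lemma support_base_polyE : plucker_support v = @base_poly m f int.
Proof.
apply/seteqP; split=> [a|a aP]; first exact: (support_base_poly hv).
have [a0 an] := base_poly_ge0 aP.
have [c ac] := exists_coloring a0 an.
exact/(transversal_support ac)/(Rado_transversal hm)/(base_poly_Rado ac).
Qed.

Lemma support_lattice_points : plucker_support v = lattice_points (polytope n V).
Proof.
rewrite support_base_polyE (polytopeE hv).
by apply/seteqP; split=> a /(base_poly_toR R).
Qed.

Lemma support_Rado (a : 'rV[int]_m) (c : 'I_n -> 'I_m) :
  (forall i, a ord0 i = #|[set r | c r == i]%SET|%:Z) ->
  (plucker_support v a <-> indep_transversal v c) /\
  (indep_transversal v c <-> Rado_condition v c).
Proof.
move=> ac.
have RT : Rado_condition v c -> indep_transversal v c by exact: Rado_transversal.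
have TS : indep_transversal v c -> plucker_support v a.
  exact: transversal_support.
have SR : plucker_support v a -> Rado_condition v c.
  by move/(support_base_poly hv); exact: base_poly_Rado.
by tauto.
Qed.

Lemma support_nonempty : plucker_support v !=set0.
Proof.
have [s [_ fs sE]] := colspan_free col (color_class [set: 'I_m]%SET).
exists (color_count s); apply/supportP; exists s; split=> //.
by move: fs; rewrite /free sE size_map => /eqP <-; exact: (proj_rank_full hv).
Qed.

Lemma support_M_convex : M_convex (plucker_support v).
Proof.
split; first exact: support_nonempty.
rewrite support_base_polyE => x y xP yP i.
by apply: base_poly_exchange xP yP; [exact: proj_rank0|exact: proj_rank_submod].
Qed.

Lemma polytope_permutohedron : generalized_permutohedron (polytope n V).
Proof.
exists (fun S => (f S)%:R); split; first by rewrite proj_rank0.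
- by move=> S T; rewrite -!natrD ler_nat proj_rank_submod.
- rewrite (polytopeE hv); apply/seteqP; split=> a [aT aS]; split=> //.
    by rewrite -setsumT.
  by rewrite setsumT.
Qed.

Lemma col_indep_le (B : {fset A}) : col_indep v B -> (#|` B| <= n)%N.
Proof. exact: (free_size_le_n hv). Qed.

Lemma col_baseP (B : {fset A}) : Defs.col_base v B <-> col_indep v B /\ #|` B| = n.
Proof.
split=> [[iB maxB]|[iB cB]]; split=> //; last first.
  move=> J iJ BJ; apply/esym/eqP; rewrite eqEfcard BJ/= cB.
  exact: col_indep_le.
apply/eqP; rewrite eqn_leq col_indep_le//=.
(* A column outside the span could be added to [B], against maximality; so the columns of [B] span
   the space of all columns, of dimension [n]. *)
have spanB k : col k \in <<map col B>>%VS.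
  apply: contrapT => /negP kB.
  have kNB : k \notin B by apply: contra kB => kB; rewrite memv_span// map_f.
  have pk : perm_eq (k |` B)%fset (k :: B).
    apply: uniq_perm; rewrite /= ?kNB ?fset_uniq//.
    by move=> l; rewrite !inE.
  have /maxB/(_ (fsubsetU1 _ _)) kBE : col_indep v (k |` B)%fset.
    by rewrite /col_indep (perm_free (perm_map col pk)) /= free_cons kB.
  by move: kNB; rewrite -kBE !inE eqxx.
rewrite -[leqLHS](proj_rank_full hv) /proj_rank.
have := iB; rewrite /col_indep /free size_map => /eqP <-.
by apply/dimvS/colspan_sub => k _.
Qed.

Lemma base_color_counts :
  [set color_count B | B in Defs.col_base v] = plucker_support v.
Proof.
apply/seteqP; split=> [_ [B /col_baseP[iB cB] <-]|a /supportP[s [sn fs <-]]].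
  by apply/supportP; exists B.
have us : uniq s by apply: (map_uniq (f := col)); exact: free_uniq.
have ps : perm_eq [fset k in s]%fset s.
  by apply: uniq_perm => // k; rewrite inE.
exists [fset k in s]%fset.
  apply/col_baseP; split; last by rewrite (perm_size ps).
  by rewrite /col_indep (perm_free (perm_map col ps)).
by apply/rowP => i; rewrite !mxE (seq.permP ps).
Qed.

(** The vectors spanning the hull are exactly the integer points of the polytope, so one inclusion
    is integrality and the other is convexity. *)
Lemma polytope_base_polytope : polytope n V = base_polytope v.
Proof.
have imE : [set toR R (color_count B) | B in Defs.col_base v] =
    @toR R m @` plucker_support v.
  by rewrite -base_color_counts image_comp.
rewrite /base_polytope imE (polytopeE hv); apply/seteqP; split.
  apply: base_poly_integral.
  - exact: proj_rank_submod.
  - move=> x y l; rewrite !inE => Cx Cy B [Bconv GB].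
    by rewrite -inE; apply: (Bconv); rewrite inE;
      [exact: (Cx B (conj Bconv GB))|exact: (Cy B (conj Bconv GB))].
  - move=> z zP B [_]; apply; exists z => //.
    by rewrite support_base_polyE; exact/(base_poly_toR R).
apply: smallest_sub; first exact: base_poly_convex.
move=> _ [z + <-]; rewrite support_base_polyE.
by move=> zP; exact/(base_poly_toR R).
Qed.

End Support.

Lemma two_colors_sets (i1 i2 : 'I_2) (S : {set 'I_2}) :
  i1 = 0%N :> nat -> i2 = 1%N :> nat ->
  [\/ S = finset.set0, S = [set i1]%SET, S = [set i2]%SET | S = [set: 'I_2]%SET].
Proof.
move=> e1 e2.
have two i : i = i1 \/ i = i2.
  by case: i => [[|[|k]] hk] //; [left|right]; apply: val_inj.
have n12 : i1 == i2 = false by apply/negbTE; rewrite -val_eqE /= e1 e2.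
have [s1|s1] := boolP (i1 \in S); have [s2|s2] := boolP (i2 \in S).
- by constructor 4; apply/setP => i; rewrite inE; case: (two i) => ->.
- constructor 2; apply/setP => i; rewrite inE; case: (two i) => ->.
    by rewrite s1 eqxx.
  by rewrite (negbTE s2) eq_sym n12.
- constructor 3; apply/setP => i; rewrite inE; case: (two i) => ->.
    by rewrite (negbTE s1) n12.
  by rewrite s2 eqxx.
- constructor 1; apply/setP => i; rewrite inE.
  by case: (two i) => ->; apply/negbTE.
Qed.

(** For two colors each singleton is the complement of the other, so the dimension of [V] inside one
    summand is [n] minus the rank of the projection to the other. *)
Lemma support_two_colors (R : realType) (m n : nat) (p : 'I_m -> R)
    (v : 'I_n -> vect R m) (V : set (vect R m)) (hm : (1 <= m)%N) (i1 i2 : 'I_m)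
    (a : 'rV[int]_m) :
  is_basis v V -> V `<=` sum_ell p -> m = 2%N -> i1 = 0%N :> nat -> i2 = 1%N :> nat ->
  plucker_support v a <->
  [/\ (subspace_dim (V `&` sub_sum p [set i1]%SET))%:Z <= a ord0 i1,
      a ord0 i1 <= n%:Z - (subspace_dim (V `&` sub_sum p [set i2]%SET))%:Z
    & a ord0 i2 = n%:Z - a ord0 i1].
Proof.
move=> hv Vp m2; subst m => e1 e2.
rewrite (support_base_polyE hm hv).
rewrite !(subspace_dimE (has_dim_inter hv _ Vp)).
have C12 (j1 j2 : 'I_2) : j1 <> j2 -> ~: [set j1]%SET = [set j2]%SET.
  move=> n12; have [k1 k2] : j1 <> j2 :> nat /\ True by split=> // /val_inj.
  apply/setP => i; rewrite !inE -!val_eqE /=.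
  by move: k1 (ltn_ord i) (ltn_ord j1) (ltn_ord j2); clear; lia.
have n12 : i1 <> i2 by move=> h; move: e1; rewrite h e2.
rewrite (C12 _ _ n12) (C12 _ _ (nesym n12)).
have f1 := proj_rank_le hv [set i1]%SET; have f2 := proj_rank_le hv [set i2]%SET.
have aTE : setsum a [set: 'I_2]%SET = a ord0 i1 + a ord0 i2.
  rewrite setsumT !big_ord_recr big_ord0 /= add0r.
  by congr (a _ _ + a _ _); apply: val_inj; rewrite /= ?e1 ?e2.
have a1E i : setsum a [set i]%SET = a ord0 i by rewrite /setsum big_set1.
split=> [[+ aS]|[h1 h2 h3]].
  have := aS [set i1]%SET; have := aS [set i2]%SET.
  rewrite !a1E aTE (proj_rank_full hv) !natz.
  by move=> h1 h2 h3; split; lia.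
split; first by rewrite aTE (proj_rank_full hv) natz; lia.
move=> S; have [->|->|->|->] := two_colors_sets S e1 e2.
- by rewrite /setsum big_set0 ler0n.
- by rewrite a1E natz; lia.
- by rewrite a1E natz; lia.
- by rewrite aTE (proj_rank_full hv) natz; lia.
Qed.

(** * Sequence spaces *)

Section Modulus.
Variable R : realType.
Local Notation C := R[i].
Implicit Types z w : C.

Lemma modulusE z : (modulus z)%:C%C = `|z|.
Proof. by rewrite /modulus RRe_real// normr_real. Qed.

Lemma modulus_ge0 z : 0 <= modulus z.
Proof. by rewrite -ler0c modulusE. Qed.

Lemma modulus0 : modulus (0 : C) = 0.
Proof. by apply: (@complexI R); rewrite modulusE normr0. Qed.

Lemma modulus1 : modulus (1 : C) = 1.
Proof. by apply: (@complexI R); rewrite modulusE normr1. Qed.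

Lemma modulus_eq0 z : modulus z = 0 -> z = 0.
Proof.
move=> /(congr1 (real_complex R)); rewrite modulusE => /eqP.
by rewrite normr_eq0 => /eqP.
Qed.

Lemma modulusM z w : modulus (z * w) = modulus z * modulus w.
Proof. by apply: (@complexI R); rewrite rmorphM/= !modulusE normrM. Qed.

Lemma modulusN z : modulus (- z) = modulus z.
Proof. by apply: (@complexI R); rewrite !modulusE normrN. Qed.

Lemma ler_modulusD z w : modulus (z + w) <= modulus z + modulus w.
Proof. by rewrite -lecR rmorphD/= !modulusE ler_normD. Qed.

Lemma modulus_real (x : R) : 0 <= x -> modulus x%:C%C = x.
Proof. by move=> x0; apply: (@complexI R); rewrite modulusE ger0_norm// ler0c. Qed.

Lemma modulusJ z : modulus (conjc z) = modulus z.
Proof. by rewrite /modulus !normc_def; case: z => a b /=; rewrite sqrrN. Qed.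

Lemma modulus_def z : modulus z = Num.sqrt (complex.Re z ^+ 2 + complex.Im z ^+ 2).
Proof. by rewrite /modulus normc_def. Qed.

Lemma ler_Re_modulus z : complex.Re z <= modulus z.
Proof.
rewrite /modulus normc_def /=; apply: le_trans (ler_norm _) _.
by rewrite -sqrtr_sqr ler_wsqrtr// lerDl sqr_ge0.
Qed.

End Modulus.

Section NonnegativeSums.
Variables (R : realType) (J : choiceType).
Implicit Types (D : set J) (a b : J -> R).

Lemma le_esum_seq D a (s : seq J) : (forall k, 0 <= a k) -> uniq s ->
  (forall k, k \in s -> D k) ->
  ((\sum_(k <- s) a k)%:E <= \esum_(k in D) (a k)%:E)%E.
Proof.
move=> a0 us sD; apply: esum_ge; exists [set` s]; first by split.
by rewrite -fsbig_seq// sumEFin.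
Qed.

Lemma esum_le_seq D a (M : \bar R) :
  (forall s : seq J, uniq s -> (forall k, k \in s -> D k) ->
     ((\sum_(k <- s) a k)%:E <= M)%E) ->
  (\esum_(k in D) (a k)%:E <= M)%E.
Proof.
move=> h; apply: ge_ereal_sup => _ [X [finX XD] <-].
rewrite fsbig_finite//= sumEFin; apply: h; first exact: fset_uniq.
by move=> k; rewrite in_fset_set// inE; exact: XD.
Qed.

Lemma esum_ltyP D a : (forall k, 0 <= a k) ->
  (\esum_(k in D) (a k)%:E < +oo)%E <->
  exists M : R, forall s : seq J, uniq s -> (forall k, k \in s -> D k) ->
     \sum_(k <- s) a k <= M.
Proof.
move=> a0; split=> [lty|[M h]].
  have fin : \esum_(k in D) (a k)%:E \is a fin_num.
    by rewrite ge0_fin_numE// esum_ge0// => k _; rewrite lee_fin.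
  exists (fine (\esum_(k in D) (a k)%:E)) => s us sD.
  by rewrite -lee_fin fineK//; exact: le_esum_seq.
apply: (@le_lt_trans _ _ M%:E); last exact: ltry.
by apply: esum_le_seq => s us sD; rewrite lee_fin; exact: h.
Qed.

End NonnegativeSums.

Section Ell.
Variables (R : realType).
Local Notation C := R[i].

Lemma ellE (J : choiceType) (D : set J) s (f : J -> C) :
  ell D s f <-> (\esum_(k in D) (modulus (f k) `^ s)%:E < +oo)%E.
Proof.
rewrite /ell /summable /=.
suff -> : \esum_(x in D) `|(modulus (f x) `^ s)%:E|%E =
  \esum_(k in D) (modulus (f k) `^ s)%:E by [].
by apply: eq_esum => k _; rewrite gee0_abs// lee_fin powR_ge0.
Qed.

Lemma ellP (J : choiceType) (D : set J) s (f : J -> C) :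
  ell D s f <-> exists M : R, forall q : seq J, uniq q ->
    (forall k, k \in q -> D k) -> \sum_(k <- q) modulus (f k) `^ s <= M.
Proof.
have nn k : 0 <= modulus (f k) `^ s by exact: powR_ge0.
split=> [/ellE h|h]; first by move: h; rewrite (esum_ltyP D nn).
by apply/ellE; rewrite (esum_ltyP D nn).
Qed.

(** Bounds [x + y] by twice the maximum. The constant is not sharp but suffices for closure of [ell]
    under sums. *)
Lemma powRD_le (x y p : R) : 0 <= x -> 0 <= y -> 0 <= p ->
  (x + y) `^ p <= 2 `^ p * (x `^ p + y `^ p).
Proof.
move=> x0 y0 p0.
wlog xy : x y x0 y0 / x <= y => [h|].
  by have [/h->//|/ltW/h] := leP x y; rewrite addrC [X in 2 `^ p * X]addrC; exact.
apply: (@le_trans _ _ ((2 * y) `^ p)).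
  by rewrite ge0_ler_powR ?nnegrE ?addr_ge0 ?mulr_ge0//; lra.
by rewrite powRM// ler_wpM2l ?powR_ge0// lerDr powR_ge0.
Qed.

Variable p : R.
Hypothesis p1 : 1 <= p.

Let p0 : 0 < p. Proof. exact: lt_le_trans ltr01 p1. Qed.

Lemma ell_linear (J : choiceType) (D : set J) c (f g : J -> C) :
  ell D p f -> ell D p g -> ell D p (c *: (f : J -> C) + g).
Proof.
move=> /ellP[M hM] /ellP[M' hM']; apply/ellP.
exists (2 `^ p * (modulus c `^ p * M + M')) => q uq qD.
apply: (@le_trans _ _ (\sum_(k <- q)
   2 `^ p * (modulus c `^ p * modulus (f k) `^ p + modulus (g k) `^ p))).
  apply: ler_sum => k _; rewrite -powRM ?modulus_ge0// -modulusM.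
  apply: (@le_trans _ _ ((modulus (c * f k) + modulus (g k)) `^ p)); last first.
    by rewrite powRD_le ?modulus_ge0 ?ltW.
  apply: ge0_ler_powR; rewrite ?nnegrE ?addr_ge0 ?modulus_ge0//.
    exact: ltW.
  exact: ler_modulusD.
rewrite -mulr_sumr ler_wpM2l ?powR_ge0// big_split/= -mulr_sumr.
by rewrite lerD ?hM'// ler_wpM2l ?powR_ge0// hM.
Qed.

Definition psum (f : nat -> C) : \bar R :=
  \esum_(k in [set: nat]) (modulus (f k) `^ p)%:E.

Lemma psum_ge0 f : (0 <= psum f)%E.
Proof. by apply: esum_ge0 => k _; rewrite lee_fin powR_ge0. Qed.

Lemma psum_fin f : ell [set: nat] p f -> psum f \is a fin_num.
Proof. by move=> /ellE; rewrite ge0_fin_numE// psum_ge0. Qed.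

Lemma ellnorm_ge0 f : 0 <= ellnorm p f.
Proof. exact: powR_ge0. Qed.

Lemma eq_ellnorm f g : (forall k, modulus (f k) = modulus (g k)) ->
  ellnorm p f = ellnorm p g.
Proof.
by move=> fg; rewrite /ellnorm; congr (fine _ `^ _); apply: eq_esum => k _; rewrite fg.
Qed.

Lemma le_ellnorm_seq f (s : seq nat) : ell [set: nat] p f -> uniq s ->
  (\sum_(k <- s) modulus (f k) `^ p) `^ p^-1 <= ellnorm p f.
Proof.
move=> fX us; apply: ge0_ler_powR; rewrite ?nnegrE ?invr_ge0.
- exact: ltW.
- by rewrite sumr_ge0// => k _; rewrite powR_ge0.
- by rewrite fine_ge0// psum_ge0.
- by rewrite -lee_fin fineK ?psum_fin// le_esum_seq// => k; rewrite powR_ge0.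
Qed.

Lemma le_modulus_ellnorm f k : ell [set: nat] p f -> modulus (f k) <= ellnorm p f.
Proof.
move=> fX; have := @le_ellnorm_seq f [:: k] fX isT.
by rewrite big_seq1 -powRrM mulfV ?gt_eqF// powRr1// modulus_ge0.
Qed.

Lemma psum_finsupp f (s : seq nat) : uniq s -> (forall k, k \notin s -> f k = 0) ->
  psum f = (\sum_(k <- s) modulus (f k) `^ p)%:E.
Proof.
move=> us f0; rewrite /psum (esumID [set` s]); last first.
  by move=> k _; rewrite lee_fin powR_ge0.
rewrite setTI [X in (_ + X)%E]esum1 ?adde0; last first.
  by move=> k [_ /negP /= ks]; rewrite f0// modulus0 powR0// gt_eqF.
rewrite esum_fset//; last by move=> k _; rewrite lee_fin powR_ge0.
  by rewrite -fsbig_seq// sumEFin.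
exact: finite_seq.
Qed.

Lemma ell_finsupp f (s : seq nat) : uniq s -> (forall k, k \notin s -> f k = 0) ->
  ell [set: nat] p f.
Proof. by move=> us f0; apply/ellE; rewrite -/(psum f) (psum_finsupp us f0) ltry. Qed.

Lemma ellnorm_finsupp f (s : seq nat) : uniq s -> (forall k, k \notin s -> f k = 0) ->
  ellnorm p f = (\sum_(k <- s) modulus (f k) `^ p) `^ p^-1.
Proof. by move=> us f0; rewrite /ellnorm -/(psum f) (psum_finsupp us f0). Qed.

(** A finite partial sum comes within [e ^ p] of the total; beyond its largest index all remaining
    terms together contribute at most [e ^ p]. *)
Lemma ellnorm_tail f e : ell [set: nat] p f -> 0 < e ->
  exists L, forall L', (L <= L')%N ->
    ellnorm p (fun k => if (k < L')%N then 0 else f k) <= e.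
Proof.
move=> fX e0; have fin := psum_fin fX; have ep0 : 0 < e `^ p by rewrite powR_gt0.
have : (psum f - (e `^ p)%:E < psum f)%E.
  by rewrite lteBlDr// lteDl// lte_fin.
move=> /ereal_sup_gt[_ [X [finX _] <-]].
rewrite fsbig_finite// sumEFin -[psum f]fineK// -EFinB lte_fin.
pose s : seq nat := fset_set X; rewrite -/s => hX.
exists (\max_(k <- s) k).+1 => L' LL'.
set h := fun k => _.
suff hle : (psum h <= (e `^ p)%:E)%E.
  have hn : psum h \is a fin_num.
    by rewrite ge0_fin_numE ?psum_ge0//; apply: le_lt_trans hle (ltry _).
  rewrite -[leRHS](powRr1 (ltW e0)) -[X in _ `^ X](@mulfV _ p) ?gt_eqF// powRrM /ellnorm.
  apply: ge0_ler_powR; rewrite ?nnegrE ?invr_ge0 ?powR_ge0 ?fine_ge0 ?psum_ge0//.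
    exact: ltW.
  by rewrite -lee_fin fineK.
apply: esum_le_seq => q uq _; rewrite lee_fin.
have uqs : uniq ([seq k <- q | (L' <= k)%N] ++ s).
  rewrite cat_uniq filter_uniq// fset_uniq andbT/=.
  apply/hasPn => k ks; rewrite mem_filter negb_and -ltnNge.
  by rewrite (leq_trans _ LL')// ltnS; exact: (@leq_bigmax_seq _ s xpredT id k ks isT).
have := @le_esum_seq _ _ [set: nat] _ _ (fun k => powR_ge0 (modulus (f k)) p) uqs
  (fun _ _ => I).
rewrite -/(psum f) -[psum f]fineK// lee_fin big_cat/= big_filter => h2.
rewrite (bigID (fun k => (L' <= k)%N))/= [X in _ + X]big1 ?addr0; last first.
  by move=> k; rewrite -ltnNge /h => ->; rewrite modulus0 powR0// gt_eqF.
rewrite (eq_bigr (fun k => modulus (f k) `^ p)); last first.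
  by move=> k; rewrite /h ltnNge => ->.
by move: hX h2; set A := \sum_(i <- s) _; set B := \sum_(i <- q | _) _; lra.
Qed.

End Ell.

(** * Absolute norms *)

Section AbsoluteNorm.
Import numFieldNormedType.Exports.
Variables (R : realType) (m : nat) (N : 'rV[R]_m -> R).
Hypothesis hN : absolute_norm N.
Implicit Types (t u : 'rV[R]_m) (i j : 'I_m).

Lemma anorm0 : N 0 = 0.
Proof. by rewrite -(scale0r (0 : 'rV[R]_m)) (anorm_homog hN) normr0 mul0r. Qed.

Lemma anormN t : N (- t) = N t.
Proof. by rewrite -scaleN1r (anorm_homog hN) normrN normr1 mul1r. Qed.

Lemma anorm_ge0 t : 0 <= N t.
Proof.
have := anorm_triangle hN t (- t); rewrite subrr anorm0 anormN.
by move: (N t) => x; lra.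
Qed.

(** Restriction to [S] is the average of [t] and of [t] with signs flipped off [S], two vectors of
    equal norm. *)
Lemma anorm_restrict (S : pred 'I_m) t :
  N (\row_i if S i then t ord0 i else 0) <= N t.
Proof.
pose t' : 'rV[R]_m := \row_i if S i then t ord0 i else - t ord0 i.
have -> : (\row_i if S i then t ord0 i else 0) = 2^-1 *: (t + t').
  by apply/rowP => i; rewrite !mxE; case: ifP => _; [field|rewrite subrr mulr0].
have Nt' : N t' = N t.
  by apply: (anorm_absolute hN) => i; rewrite mxE; case: ifP; rewrite ?normrN.
rewrite (anorm_homog hN) ger0_norm ?invr_ge0//.
have := anorm_triangle hN t t'; rewrite Nt'; move: (N t) (N _) => x y; lra.
Qed.

Definition pair_row i j (s t : R) : 'rV[R]_m :=
  s *: delta_mx ord0 i + t *: delta_mx ord0 j.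

Lemma pair_rowE i j (s r : R) k : i != j ->
  pair_row i j s r ord0 k = if k == i then s else if k == j then r else 0.
Proof.
move=> ij; rewrite !mxE eqxx /=.
have [->|ki] := eqVneq k i; first by rewrite (negbTE ij) mulr1 mulr0 addr0.
by have [_|_] := eqVneq k j; rewrite ?mulr0 ?mulr1 ?add0r ?addr0.
Qed.

Lemma single_rowE i (s : R) k :
  (s *: delta_mx ord0 i : 'rV[R]_m) ord0 k = if k == i then s else 0.
Proof. by rewrite !mxE eqxx /=; case: eqVneq => _; rewrite ?mulr1 ?mulr0. Qed.

Lemma anorm_pair i j t : i != j -> N (pair_row i j (t ord0 i) (t ord0 j)) <= N t.
Proof.
move=> ij; apply: le_trans (anorm_restrict (pred2 i j) t).
suff -> : pair_row i j (t ord0 i) (t ord0 j) =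
    \row_k (if pred2 i j k then t ord0 k else 0) by [].
apply/rowP => k; rewrite pair_rowE// mxE /=.
by case: (eqVneq k i) => [->//|_]; case: (eqVneq k j) => [->|].
Qed.

Hypothesis nN : normalized N.

Lemma anorm_single i s : N (s *: delta_mx ord0 i) = `|s|.
Proof. by rewrite (anorm_homog hN) nN mulr1. Qed.

Lemma anorm_coord i t : `|t ord0 i| <= N t.
Proof.
rewrite -(anorm_single i); apply: le_trans (anorm_restrict (pred1 i) t).
rewrite le_eqVlt; apply/orP; left; apply/eqP; congr N.
by apply/rowP => k; rewrite !mxE eqxx /=; case: eqVneq => [->|]; rewrite ?mulr1 ?mulr0.
Qed.

Lemma anorm_le_sum t : N t <= \sum_i `|t ord0 i|.
Proof.
have {1}-> : t = \sum_i t ord0 i *: delta_mx ord0 i by exact: row_sum_delta.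
elim/big_rec2: _ => [|i y x _ h]; first by rewrite anorm0.
by apply: le_trans (anorm_triangle hN _ _) _; rewrite anorm_single lerD2l.
Qed.

(* The minimum [c] of [N] on the segment [s + t = 1] can be taken at an interior
   point, because [N <= s + t]; there [c (s + t)] is a supporting functional. *)
Lemma anorm_support i j : i != j -> exists s r c : R,
  [/\ [/\ 0 < s, 0 < r & 0 < c], s + r = 1, N (pair_row i j s r) = c
    & forall s' r', 0 <= s' -> 0 <= r' -> c * (s' + r') <= N (pair_row i j s' r')].
Proof.
move=> ij; pose h s := N (pair_row i j s (1 - s)).
have Npair s r : N (pair_row i j s r) <= `|s| + `|r|.
  by apply: le_trans (anorm_triangle hN _ _) _; rewrite !anorm_single.
have h_lip x y : `|h x - h y| <= 2 * `|x - y|.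
  have le_h a b : h a - h b <= 2 * `|a - b|.
    have -> : 2 * `|a - b| = `|a - b| + `|b - a| by rewrite (distrC b); ring.
    rewrite lerBlDl; apply: le_trans (_ : _ <= h b + N (pair_row i j (a - b) (b - a))) _.
      apply: le_trans (anorm_triangle hN _ _); rewrite le_eqVlt; apply/orP; left.
      apply/eqP; congr N; apply/rowP => k; rewrite !mxE.
      by move: (_%:R) (_%:R) => ? ?; ring.
    by rewrite lerD2l.
  rewrite ler_norml le_h andbT; have := le_h y x.
  by rewrite distrC; move: (h x) (h y) => u v; lra.
have h_cont : continuous h.
  move=> x; apply/cvgrPdist_le => e e0; near=> y.
  apply: le_trans (h_lip _ _) _.
  rewrite mulrC -ler_pdivlMr//.
  by near: y; apply: cvgr_dist_le => //; rewrite divr_gt0.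
have /(EVT_min ler01)[s0 s01 s0_min] : {within `[0, 1], continuous h}.
  exact: continuous_subspaceT.
have h_scale s' r' : 0 <= s' -> 0 <= r' -> h s0 * (s' + r') <= N (pair_row i j s' r').
  move=> s'0 r'0; have [st0|st0] := eqVneq (s' + r') 0.
    by rewrite st0 mulr0 anorm_ge0.
  have st : 0 < s' + r' by rewrite lt_neqAle eq_sym st0 addr_ge0.
  have -> : pair_row i j s' r' =
      (s' + r') *: pair_row i j (s' / (s' + r')) (1 - s' / (s' + r')).
    rewrite /pair_row scalerDr !scalerA; congr (_ *: _ + _ *: _); by field.
  rewrite (anorm_homog hN) gtr0_norm// mulrC; apply: ler_wpM2l; first exact: ltW.
  apply: (s0_min (s' / (s' + r'))).
  by rewrite in_itv/= divr_ge0 ?(ltW st)//= ler_pdivrMr// mul1r lerDl.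
have h_gt0 s : 0 < h s.
  rewrite lt_neqAle anorm_ge0 andbT eq_sym; apply/eqP => /(anorm_definite hN).
  have ji : (j == i) = false by rewrite eq_sym (negbTE ij).
  move=> /rowP e; have := e i; have := e j.
  by rewrite !mxE !eqxx /= ji (negbTE ij) !mulr0 !mulr1; lra.
have h0 : h 0 = 1 by rewrite /h /pair_row scale0r add0r subr0 scale1r nN.
have h1 : h 1 = 1 by rewrite /h /pair_row subrr scale0r addr0 scale1r nN.
have hle : h s0 <= 1 by rewrite -h0 s0_min// in_itv/= lexx ler01.
(* If the minimum is 1, [h] is constantly 1 since [N] is at most the sum of the coordinates, and the
   midpoint serves. Otherwise [s0] is not an endpoint, where [h] equals 1. *)
have [hE|hN1] := eqVneq (h s0) 1.
  have half : 2^-1 + 2^-1 = 1 :> R by lra.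
  have half0 : 0 <= 2^-1 :> R by lra.
  exists 2^-1, 2^-1, (h s0); split=> //.
  apply/eqP; rewrite eq_le; apply/andP; split.
    by rewrite hE; apply: le_trans (Npair _ _) _; rewrite !ger0_norm// half.
  by have := h_scale _ _ half0 half0; rewrite half mulr1.
exists s0, (1 - s0), (h s0); split=> //; last by ring.
have : s0 != 0 by apply: contra hN1 => /eqP ->; rewrite h0.
have : s0 != 1 by apply: contra hN1 => /eqP ->; rewrite h1.
move: s01; rewrite in_itv/= => /andP[a b] c d; split=> //.
  by rewrite lt_neqAle eq_sym d.
by rewrite subr_gt0 lt_neqAle c.
Unshelve. all: by end_near. Qed.

End AbsoluteNorm.

Section SumSpace.
(* Unification would otherwise unfold [ellnorm] down to the definition of [esum]. *)
Local Opaque ellnorm.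
Variables (R : realType) (m : nat) (p : 'I_m -> R).
Hypothesis hp : forall i, 1 <= p i.
Local Notation C := R[i].
Local Notation vect := (vect R m).
Local Notation A := (idx m).
Local Notation X := (sum_ell p).
Implicit Types (x y : vect) (k l : A) (i j : 'I_m).

Definition basis_vec k : vect := fun l => (l == k)%:R.

Definition inj_vec i (f : nat -> C) : vect := fun k => if color k == i then f k.2 else 0.

Definition linear_on (E F : lmodType C) (D : set E) (phi : E -> F) :=
  forall c a b, D a -> D b -> phi (c *: a + b) = c *: phi a + phi b.

Lemma sum_ell_linear c x y : X x -> X y -> X (c *: x + y).
Proof. by move=> Xx Xy i; exact: (ell_linear (hp i) c (Xx i) (Xy i)). Qed.

Lemma sum_ell_dominated x y : X x -> (forall k, modulus (y k) <= modulus (x k)) -> X y.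
Proof.
move=> Xx yx i; have /ellP[M hM] := Xx i; apply/ellP; exists M => q uq qD.
apply: le_trans (hM q uq qD); apply: ler_sum => k _.
apply: ge0_ler_powR; rewrite ?nnegrE ?modulus_ge0//.
  by apply: le_trans (hp i); rewrite ler01.
exact: yx.
Qed.

Lemma part_inj_vec i f : part (inj_vec i f) i = f.
Proof. by apply/funext => k; rewrite /part /inj_vec eqxx. Qed.

Lemma part_inj_vec_neq i j f : j != i -> part (inj_vec i f) j = 0.
Proof. by move=> ji; apply/funext => k; rewrite /part /inj_vec (negbTE ji). Qed.

Lemma ell0 i : ell [set: nat] (p i) (0 : nat -> C).
Proof. exact: (@ell_finsupp _ _ (hp i) _ [::]). Qed.

Lemma ellnorm0 i : ellnorm (p i) (0 : nat -> C) = 0.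
Proof.
rewrite (@ellnorm_finsupp _ _ (hp i) _ [::])// big_nil powR0// invr_eq0.
by rewrite gt_eqF// (lt_le_trans ltr01).
Qed.

Lemma sum_ell_inj i f : ell [set: nat] (p i) f -> X (inj_vec i f).
Proof.
move=> fX j; have [->|ji] := eqVneq j i; first by rewrite part_inj_vec.
by rewrite part_inj_vec_neq//; exact: ell0.
Qed.

Lemma sum_ell0 : X 0.
Proof. by move=> i; exact: ell0. Qed.

Lemma sum_ell_finsupp x (s : seq A) : (forall k, k \notin s -> x k = 0) -> X x.
Proof.
move=> x0 i; apply: (@ell_finsupp _ _ (hp i) _ (undup [seq k.2 | k <- s])).
  exact: undup_uniq.
move=> l; rewrite mem_undup => ls; apply: x0; apply: contra ls => ils.
by apply/mapP; exists (i, l).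
Qed.

Lemma sum_ell_basis k : X (basis_vec k).
Proof.
apply: (@sum_ell_finsupp _ [:: k]) => l.
by rewrite inE /basis_vec => /negbTE ->.
Qed.

Section SumNorm.
Variable N : 'rV[R]_m -> R.
Hypotheses (hN : absolute_norm N) (nN : normalized N).
Local Notation nu := (sum_norm p N).

Lemma sum_norm_part x i : ellnorm (p i) (part x i) <= nu x.
Proof.
apply: le_trans (anorm_coord hN nN i _); rewrite mxE ger0_norm//.
exact: ellnorm_ge0.
Qed.

Lemma sum_norm_pair x i j : i != j ->
  N (pair_row i j (ellnorm (p i) (part x i)) (ellnorm (p j) (part x j))) <= nu x.
Proof.
move=> ij; rewrite /sum_norm; set t := (X in _ <= N X).
by apply: le_trans (anorm_pair hN t ij); rewrite !mxE.
Qed.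

Lemma sum_norm_pairE x i j : i != j ->
  (forall k, color k != i -> color k != j -> x k = 0) ->
  nu x = N (pair_row i j (ellnorm (p i) (part x i)) (ellnorm (p j) (part x j))).
Proof.
move=> ij x0; rewrite /sum_norm; congr (N _); apply/rowP => k; rewrite mxE pair_rowE//.
have [->//|ki] := eqVneq k i; have [->//|kj] := eqVneq k j.
rewrite (_ : part x k = 0) ?ellnorm0//.
by apply/funext => l; exact: x0.
Qed.

Lemma eq_sum_norm x y : (forall k, modulus (x k) = modulus (y k)) -> nu x = nu y.
Proof.
move=> xy.
have normE : (fun i => ellnorm (p i) (part x i)) = (fun i => ellnorm (p i) (part y i)).
  by apply/funext => i; apply: eq_ellnorm => l; exact: (xy (i, l)).
exact: (congr1 (fun a : 'I_m -> R => N (\row_i a i)) normE).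
Qed.

Lemma sum_norm_inj i f : nu (inj_vec i f) = ellnorm (p i) f.
Proof.
rewrite -[RHS]ger0_norm ?ellnorm_ge0// -(anorm_single hN nN i).
rewrite /sum_norm; congr (N _); apply/rowP => j; rewrite mxE single_rowE.
have [->|ji] := eqVneq j i; first by rewrite part_inj_vec.
by rewrite part_inj_vec_neq// ellnorm0.
Qed.

Lemma sum_norm_single x i : (forall k, color k != i -> x k = 0) ->
  nu x = ellnorm (p i) (part x i).
Proof.
move=> x0; rewrite -sum_norm_inj; congr nu; apply/funext => -[j l].
by rewrite /inj_vec /part /=; case: eqVneq => [->//|ji]; exact: x0.
Qed.

Lemma sum_norm_coord x k : X x -> modulus (x k) <= nu x.
Proof.
move=> Xx; apply: le_trans (sum_norm_part x (color k)).
by case: k => i l; exact: (le_modulus_ellnorm (hp i) l (Xx i)).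
Qed.

Lemma sum_norm_eq0 x : X x -> nu x = 0 -> x = 0.
Proof.
move=> Xx x0; apply/funext => k; apply: modulus_eq0; apply/eqP.
by rewrite eq_le modulus_ge0 andbT -x0 sum_norm_coord.
Qed.

Lemma sum_norm0 : nu 0 = 0.
Proof.
rewrite /sum_norm (_ : \row_i _ = 0) ?anorm0//; apply/rowP => i.
by rewrite mxE (_ : part 0 i = 0)// ellnorm0 mxE.
Qed.

Lemma sum_norm_le_sum x : nu x <= \sum_i ellnorm (p i) (part x i).
Proof.
apply: le_trans (anorm_le_sum hN nN _) _; apply: ler_sum => i _.
by rewrite mxE ger0_norm// ellnorm_ge0.
Qed.

(* [phi] vanishes on the finitely supported truncations of [x], which converge to [x]. *)
Lemma vanishing_functional (phi : vect -> C) x :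
  linear_on (F := C^o) X phi -> (forall y, X y -> modulus (phi y) <= nu y) ->
  X x -> (forall k, x k != 0 -> phi (basis_vec k) = 0) -> phi x = 0.
Proof.
move=> lin bd Xx phi0; apply: modulus_eq0.
apply/eqP; rewrite eq_le modulus_ge0 andbT; apply/ler_addgt0Pl => e e0; rewrite addr0.
(* The error is shared among the [m] summands; dividing by [m + 1] keeps the denominator nonzero. *)
have em : 0 < e / m.+1%:R by rewrite divr_gt0.
have tail i := ellnorm_tail (hp i) (Xx i) em.
have /choice[L hL] := tail.
pose L0 := \max_i L i.
pose t : vect := fun k => if (k.2 < L0)%N then 0 else x k.
pose h : vect := \sum_(i < m) \sum_(l < L0) x (i, l : nat) *: basis_vec (i, l : nat).
have xE : x = 1 *: h + t.
  rewrite scale1r; apply/funext => -[i l].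
  have -> : (h + t) (i, l) = h (i, l) + t (i, l) by [].
  rewrite /h vect_sumE (bigD1 i)//= [X in _ + X + _]big1 ?addr0; last first.
    move=> j ji; rewrite vect_sumE big1// => q _.
    have -> : (x (j, q : nat) *: basis_vec (j, q : nat)) (i, l) =
      x (j, q : nat) * ((i, l) == (j, q : nat))%:R by [].
    by rewrite xpair_eqE eq_sym (negbTE ji) mulr0.
  rewrite vect_sumE /t /=.
  have bE (q : 'I_L0) : (x (i, q : nat) *: basis_vec (i, q : nat)) (i, l) =
      x (i, q : nat) * (l == q)%:R.
    by rewrite -[(_ *: _) _]/(_ * _) /basis_vec xpair_eqE eqxx.
  under eq_bigr do rewrite bE.
  case: ltnP => lL.
    rewrite addr0 (bigD1 (Ordinal lL))//= eqxx mulr1 big1 ?addr0// => q ql.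
    by rewrite (_ : (l == q) = false) ?mulr0//;
      apply: contraNF ql => /eqP lq; apply/eqP/val_inj.
  rewrite big1 ?add0r// => q _.
  by rewrite (_ : (l == q) = false) ?mulr0//; apply/negbTE;
    rewrite neq_ltn (leq_trans (ltn_ord q) lL) orbT.
pose P y := X y /\ phi y = 0.
have phi_0 : phi 0 = 0.
  have := lin 1 0 0 sum_ell0 sum_ell0.
  by rewrite !scale1r addr0 => /eqP; rewrite -subr_eq subrr eq_sym => /eqP.
have P0 : P 0 by split; [exact: sum_ell0|].
have PD y z : P y -> P z -> P (y + z).
  move=> [Xy y0] [Xz z0]; rewrite -[y]scale1r; split; first exact: sum_ell_linear.
  by rewrite lin// y0 z0 scaler0 addr0.
have Pk k : P (x k *: basis_vec k).
  rewrite -[_ *: _]addr0; split.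
    by apply: sum_ell_linear; [exact: sum_ell_basis|exact: sum_ell0].
  rewrite lin; [|exact: sum_ell_basis|exact: sum_ell0].
  rewrite phi_0 addr0; have [->|xk] := eqVneq (x k) 0; first by rewrite scale0r.
  by rewrite phi0// scaler0.
have [Xh h0] : P h.
  by apply: (big_ind P) => // i _; apply: (big_ind P).
have Xt : X t.
  apply: sum_ell_dominated Xx _ => k; rewrite /t; case: ifP => // _.
  by rewrite modulus0 modulus_ge0.
rewrite xE lin// h0 scaler0 add0r.
apply: le_trans (bd _ Xt) _; apply: le_trans (sum_norm_le_sum _) _.
apply: (@le_trans _ _ (\sum_(i < m) (e / m.+1%:R))).
  apply: ler_sum => i _; apply: le_trans (hL i L0 _).
    by rewrite le_eqVlt; apply/orP; left; apply/eqP; congr ellnorm; apply/funext.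
  exact: (@leq_bigmax _ L i).
rewrite sumr_const card_ord -[leLHS]mulr_natr mulrAC ler_pdivrMr//.
by rewrite ler_pM2l// ler_nat.
Qed.

End SumNorm.
End SumSpace.

(** * Isometries of the sum *)

Section DualWeights.
Variable R : realType.
Implicit Types a b p : R.

(** Hölder's inequality: [(a^(p-1), b^(p-1))] is the functional norming the unit vector [(a, b)] of
    the [l^p] plane. The case [p = 1], whose conjugate exponent is infinite, is separate. *)
Lemma dual_weight_le p a b y1 y2 : 1 <= p -> 0 <= a -> 0 <= b ->
  a `^ p + b `^ p = 1 -> 0 <= y1 -> 0 <= y2 ->
  a `^ (p - 1) * y1 + b `^ (p - 1) * y2 <= (y1 `^ p + y2 `^ p) `^ p^-1.
Proof.
move=> p1 a0 b0 ab y10 y20; have p0 : 0 < p by lra.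
have [->|pn1] := eqVneq p 1.
  by rewrite subrr !powRr0 invr1 !powRr1 ?addr_ge0// !mul1r.
have p1' : 0 < p - 1 by rewrite subr_gt0 lt_neqAle eq_sym pn1.
have q0 : 0 < p / (p - 1) by rewrite divr_gt0.
have pq : p^-1 + (p / (p - 1))^-1 = 1.
  rewrite invf_div -{1}[p^-1]mul1r -mulrDl; have -> : 1 + (p - 1) = p by ring.
  by rewrite mulfV// gt_eqF.
have := hoelder2 y10 y20 (powR_ge0 a (p - 1)) (powR_ge0 b (p - 1)) p0 q0 pq.
have pE : (p - 1) * (p / (p - 1)) = p by field; rewrite gt_eqF.
rewrite -!powRrM pE ab powR1 mulr1; apply: le_trans.
by rewrite [X in _ <= X + _]mulrC [X in _ <= _ + X]mulrC.
Qed.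

(** Equality would mean [a^(p-2) = b^(p-2)], hence [a = b] by taking logarithms; this is where
    exponent 2 is excluded. *)
Lemma weights_neq p a b : p != 2 -> 0 < a -> 0 < b -> a != b ->
  b * a `^ (p - 1) != a * b `^ (p - 1).
Proof.
move=> p2 a0 b0 ab; apply: contra ab => /eqP abE.
have powE x : 0 < x -> x `^ (p - 1) = x * x `^ (p - 2).
  move=> x0; have -> : p - 1 = 1 + (p - 2) by ring.
  rewrite (@powRD _ x 1 (p - 2)); last by rewrite (gt_eqF x0) implybT.
  by rewrite powRr1// ltW.
move: abE; rewrite !powE// mulrCA => /(mulfI (lt0r_neq0 a0)) /(mulfI (lt0r_neq0 b0)).
move/(congr1 (@ln R)); rewrite !ln_powR => /(mulfI _) abE.
by apply/eqP/(@ln_inj R); rewrite ?posrE//; apply: abE; rewrite subr_eq0.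
Qed.

Lemma half_weight (r : R) : 1 <= r -> exists a : R,
  [/\ 0 < a, a != 1 & a `^ r + a `^ r = 1].
Proof.
move=> r1; have r0 : 0 < r by lra.
have h0 : 0 < 2^-1 :> R by rewrite invr_gt0.
exists (2^-1 `^ r^-1); split; first exact: powR_gt0.
  by rewrite powR_eq1 !negb_or -leNgt (ltW h0) invr_eq0 (gt_eqF r0) andbT lt_eqF//; lra.
by rewrite -powRrM mulVf ?gt_eqF// (powRr1 (ltW h0)); lra.
Qed.

Lemma thirds_weight (r : R) : 1 <= r -> exists a b : R,
  [/\ 0 < a, 0 < b, a != b & a `^ r + b `^ r = 1].
Proof.
move=> r1; have r0 : 0 < r by lra.
have h0 : 0 < 3^-1 :> R by rewrite invr_gt0.
have h1 : 0 < 2 / 3 :> R by lra.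
have hE c : 0 < c -> (c `^ r^-1) `^ r = c.
  by move=> c0; rewrite -powRrM mulVf ?gt_eqF// powRr1 ?ltW.
exists (3^-1 `^ r^-1), ((2 / 3) `^ r^-1); split; try exact: powR_gt0.
  by apply/eqP => /(congr1 (fun c => c `^ r)); rewrite !hE//; lra.
by rewrite !hE//; lra.
Qed.

End DualWeights.

(** * Relations extracted from phases *)

Section Polarization.
Variable R : realType.
Local Notation C := R[i].
Implicit Types z v : C.

Lemma ReD z w : complex.Re (z + w : C) = complex.Re z + complex.Re w.
Proof. by case: z w => [? ?] [? ?]. Qed.

Lemma ImD z w : complex.Im (z + w : C) = complex.Im z + complex.Im w.
Proof. by case: z w => [? ?] [? ?]. Qed.

Lemma mulcJ_unimodular v : modulus v = 1 -> v * conjc v = 1.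
Proof.
rewrite modulus_def; case: v => a b /= h.
have : a ^+ 2 + b ^+ 2 = 1.
  by rewrite -[LHS]sqr_sqrtr ?h ?expr1n// addr_ge0// sqr_ge0.
move=> ab; apply/eqP; rewrite eq_complex /=; apply/andP; split; apply/eqP.
  by rewrite -ab; ring.
by ring.
Qed.

(** Near [lam = 1] on the circle, the first-order variation of [Re ((lam - 1) * z)] is proportional
    to [Im z] and changes sign with the direction. *)
Lemma unimodular_rotation_real z :
  (forall lam : C, modulus lam = 1 -> complex.Re ((lam - 1) * z) <= 0) ->
  complex.Im z = 0.
Proof.
case: z => a b h /=.
have key (t : R) : 0 <= t ^+ 2 * a + t * b.
  have d0 : 0 < 1 + t ^+ 2 by rewrite ltr_pwDl// sqr_ge0.
  have dn : 1 + t ^+ 2 != 0 by rewrite gt_eqF.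
  (* Rational parametrization of the circle: the condition becomes [t^2 a + t b >= 0] for all real
     [t]. The value of [t] substituted below is small enough for the linear term to win, and makes
     the expression negative unless [b = 0]. *)
  pose lam : C := Complex ((1 - t ^+ 2) / (1 + t ^+ 2)) (2 * t / (1 + t ^+ 2)).
  have lam1 : modulus lam = 1.
    by rewrite modulus_def /= (_ : _ + _ = 1) ?sqrtr1//; field.
  have := h _ lam1; rewrite /lam /=.
  rewrite (_ : _ - _ = - (2 / (1 + t ^+ 2)) * (t ^+ 2 * a + t * b)); last first.
    by field.
  rewrite mulNr oppr_le0 pmulr_rge0// divr_gt0//.
apply/eqP; rewrite -sqrf_eq0 eq_le sqr_ge0 andbT.
have a0 : 0 < `|a| + 1 by rewrite ltr_pwDr.
have an : `|a| + 1 != 0 by rewrite gt_eqF.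
have := key (- (b / (2 * (`|a| + 1)))).
have -> : (- (b / (2 * (`|a| + 1)))) ^+ 2 * a + - (b / (2 * (`|a| + 1))) * b =
  b ^+ 2 * (a - 2 * (`|a| + 1)) / (4 * (`|a| + 1) ^+ 2) by field.
rewrite pmulr_lge0; last by rewrite invr_gt0 mulr_gt0// exprn_gt0.
have : a <= `|a| by exact: ler_norm.
have := sqr_ge0 b; move: (b ^+ 2) (`|a|) a0 => x y y0 x0 ay h'.
rewrite leNgt; apply/negP => xp; move: h'; rewrite pmulr_rge0//; lra.
Qed.

(** Summing over [e = 1, -1] removes the terms odd in [e]; subtracting the value at [-v] keeps only
    those odd in [v], the two cross terms of [k] and [l]. Evaluation at [v = 1] and [v = i] gives
    the imaginary and the real part of the relation. *)
Lemma polarization (al be ga A B G : R) (fk fl fq gk gl gq : C) :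
  (forall v e : C, modulus v = 1 -> e ^+ 2 = 1 ->
    complex.Im ((al%:C%C * gk + be%:C%C * v * gl + ga%:C%C * e * gq) *
      (A%:C%C * fk + B%:C%C * conjc v * fl + G%:C%C * e * fq)) = 0) ->
  (be * A)%:C%C * (fk * gl) = (al * B)%:C%C * conjc (fl * gk).
Proof.
move=> h.
have sum4 v : modulus v = 1 ->
    complex.Im ((be * A)%:C%C * v * (fk * gl) + (al * B)%:C%C * conjc v * (fl * gk)) = 0.
  move=> v1; have vN : modulus (- v) = 1 by rewrite modulusN.
  have e1 : (1 : C) ^+ 2 = 1 by rewrite expr1n.
  have eN : (-1 : C) ^+ 2 = 1 by rewrite sqrrN expr1n.
  have := h v 1 v1 e1; have := h v (-1) v1 eN.
  have := h (- v) 1 vN e1; have := h (- v) (-1) vN eN.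
  rewrite !rmorphN /=; move: (conjc v) => w.
  set P1 := (X in complex.Im X = 0 -> _); move=> H1.
  set P2 := (X in complex.Im X = 0 -> _); move=> H2.
  set P3 := (X in complex.Im X = 0 -> _); move=> H3.
  set P4 := (X in complex.Im X = 0 -> _); move=> H4.
  set Q := (X in complex.Im X = 0).
  have PQ : P4 + P3 = P2 + P1 + (Q + Q + (Q + Q)).
    by rewrite /P1 /P2 /P3 /P4 /Q !rmorphM /=; ring.
  have := congr1 (@complex.Im R) PQ; rewrite !ImD H1 H2 H3 H4; lra.
have i1 : modulus ('i%C : C) = 1 by rewrite modulus_def /= expr0n expr1n add0r sqrtr1.
have := sum4 1 (modulus1 R); have := sum4 _ i1.
case: (fk * gl) (fl * gk) => [a b] [c d] /=.
move=> hi h1; apply/eqP; rewrite eq_complex /=; apply/andP; split; apply/eqP; lra.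
Qed.

End Polarization.

(** * Off-diagonal entries of the rank-one operator *)

Section RankOne.
Local Opaque ellnorm.
Variables (R : realType) (m : nat) (p : 'I_m -> R) (N : 'rV[R]_m -> R).
Hypotheses (hp : forall i, 1 <= p i) (p2 : forall i, p i != 2).
Hypotheses (hN : absolute_norm N) (nN : normalized N).
Local Notation C := R[i].
Local Notation vect := (vect R m).
Local Notation A := (idx m).
Local Notation X := (sum_ell p).
Local Notation nu := (sum_norm p N).
Local Notation e_ := (@basis_vec R m).
Implicit Types (x y : vect) (k l q : A) (i j : 'I_m).

Lemma linear_on0 (phi : vect -> C) : linear_on (F := C^o) X phi -> phi 0 = 0.
Proof.
move=> lin; have := lin 1 0 0 (sum_ell0 hp) (sum_ell0 hp).
by rewrite !scale1r addr0 => /eqP; rewrite -subr_eq subrr eq_sym => /eqP.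
Qed.

Variables (f : vect) (g : vect -> C).
Hypotheses (Xf : X f) (g_lin : linear_on (F := C^o) X g).
Hypothesis fg_rot : forall x lam, X x -> modulus lam = 1 ->
  nu (x + ((lam - 1) * g x) *: f) = nu x.

(** The rotated vector has the same norm as [x], so [Re phi] cannot increase along the rotation:
    [Re ((lam - 1) * (g x * phi f)) <= 0] for every unimodular [lam]. *)
Lemma norming_functional_real (phi : vect -> C) x :
  linear_on (F := C^o) X phi -> (forall y, X y -> complex.Re (phi y) <= nu y) ->
  X x -> complex.Re (phi x) = nu x -> complex.Im (g x * phi f) = 0.
Proof.
move=> lin bd Xx phix; apply: unimodular_rotation_real => lam lam1.
have Xy : X (((lam - 1) * g x) *: f + x) by exact: sum_ell_linear.
have := bd _ Xy; rewrite addrC fg_rot// addrC lin// ReD phix gerDr.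
by rewrite -[_ *: _]/(_ * _) mulrA.
Qed.

(** The nesting and the final [0] let [linear_on], stated for [c *: a + b], be applied one term at a
    time. *)
Definition trivec (a b c : C) k l q : vect := a *: e_ k + (b *: e_ l + (c *: e_ q + 0)).

Lemma trivecE a b c k l q n :
  trivec a b c k l q n = a * (n == k)%:R + b * (n == l)%:R + c * (n == q)%:R.
Proof.
have -> : trivec a b c k l q n =
    a * (n == k)%:R + (b * (n == l)%:R + (c * (n == q)%:R + 0)) by [].
by rewrite addr0 addrA.
Qed.

Lemma sum_ell_trivec a b c k l q : X (trivec a b c k l q).
Proof.
have Xe n := sum_ell_basis hp n; have X0 := sum_ell0 hp.
have Xq := sum_ell_linear hp c (Xe q) X0.
exact: (sum_ell_linear hp a (Xe k) (sum_ell_linear hp b (Xe l) Xq)).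
Qed.

Lemma linear_on_trivec (phi : vect -> C) a b c k l q : linear_on (F := C^o) X phi ->
  phi (trivec a b c k l q) = a * phi (e_ k) + b * phi (e_ l) + c * phi (e_ q).
Proof.
move=> lin; have Xe n := sum_ell_basis hp n; have X0 := sum_ell0 hp.
have Xq := sum_ell_linear hp c (Xe q) X0.
have Xl := sum_ell_linear hp b (Xe l) Xq.
rewrite /trivec (lin _ _ _ (Xe k) Xl) (lin _ _ _ (Xe l) Xq) (lin _ _ _ (Xe q) X0).
by rewrite (linear_on0 lin) addr0 addrA.
Qed.

Lemma coefficient_relation k l q (al be ga a b c : R) :
  0 <= a -> 0 <= b -> 0 <= c -> k != l -> k != q -> l != q ->
  (forall v e : C, modulus v = 1 -> modulus e = 1 ->
     nu (trivec al%:C%C (be%:C%C * v) (ga%:C%C * e) k l q) = al * a + be * b + ga * c) ->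
  (forall y, X y -> a * modulus (y k) + b * modulus (y l) + c * modulus (y q) <= nu y) ->
  (be * a)%:C%C * (f k * g (e_ l)) = (al * b)%:C%C * conjc (f l * g (e_ k)).
Proof.
move=> a0 b0 c0 kl kq lq nuE bd.
apply: (@polarization _ al be ga a b c _ _ (f q) _ _ (g (e_ q))) => v e v1 e1.
have me : modulus e = 1.
  apply/eqP; rewrite -(@eqrXn2 _ 2)// ?modulus_ge0// expr1n expr2 -modulusM -expr2 e1.
  by rewrite modulus1.
pose x := trivec al%:C%C (be%:C%C * v) (ga%:C%C * e) k l q.
(* The phases of [phi] cancel those of [x] (with [e] equal to its own conjugate since [e^2 = 1]), so
   [phi] norms [x] for every choice of [v] and [e]. *)
pose phi y : C := a%:C%C * y k + b%:C%C * conjc v * y l + c%:C%C * e * y q.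
have Xx : X x by exact: sum_ell_trivec.
have phi_lin : linear_on (F := C^o) X phi.
  move=> d y z _ _; rewrite -[RHS]/(d * phi y + phi z) /phi.
  have yzE n : (d *: y + z) n = d * y n + z n by [].
  by rewrite !yzE; ring.
rewrite -[X in X * _](linear_on_trivec _ _ _ _ _ _ g_lin) -/x -/(phi f).
apply: norming_functional_real => // [y Xy|].
  apply: le_trans (bd y Xy); apply: le_trans (ler_Re_modulus _) _.
  rewrite /phi; apply: le_trans (ler_modulusD _ _) _.
  rewrite lerD//; last by rewrite !modulusM me mulr1 modulus_real.
  apply: le_trans (ler_modulusD _ _) _.
  by rewrite !modulusM modulusJ v1 mulr1 !modulus_real.
rewrite nuE// /phi /x !trivecE !eqxx (negbTE kl) (negbTE kq) (negbTE lq).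
rewrite ![_ == k]eq_sym ![q == l]eq_sym (negbTE kl) (negbTE kq) (negbTE lq).
rewrite !mulr0 !mulr1 !addr0 !add0r.
have -> : a%:C%C * al%:C%C + b%:C%C * conjc v * (be%:C%C * v) + c%:C%C * e * (ga%:C%C * e)
    = (al * a + be * b + ga * c)%:C%C by
  rewrite !rmorphD !rmorphM /=; transitivity
   (a%:C%C * al%:C%C + b%:C%C * be%:C%C * (v * conjc v) + c%:C%C * ga%:C%C * (e ^+ 2));
   [ring | rewrite mulcJ_unimodular// e1; ring].
by [].
Qed.

Lemma part_pair_ge y i (k q : nat) : X y -> k != q ->
  (modulus (y (i, k)) `^ p i + modulus (y (i, q)) `^ p i) `^ (p i)^-1
    <= ellnorm (p i) (part y i).
Proof.
move=> Xy kq; have := @le_ellnorm_seq _ _ (hp i) _ [:: k; q] (Xy i).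
by rewrite /= inE kq => /(_ isT); rewrite !big_cons big_nil addr0.
Qed.

Lemma ellnorm_pair i (h : nat -> C) (k q : nat) : k != q ->
  (forall n, n != k -> n != q -> h n = 0) ->
  ellnorm (p i) h = (modulus (h k) `^ p i + modulus (h q) `^ p i) `^ (p i)^-1.
Proof.
move=> kq h0; rewrite (@ellnorm_finsupp _ _ (hp i) _ [:: k; q]) /= ?inE ?kq//.
  by rewrite !big_cons big_nil addr0.
by move=> n; rewrite !inE negb_or => /andP[]; exact: h0.
Qed.

Lemma same_color_vanish i (k l : nat) : k != l -> f (i, k) * g (e_ (i, l)) = 0.
Proof.
move=> kl; pose q := (k + l).+1.
have kq : k != q by rewrite neq_ltn /q ltnS leq_addr.
have lq : l != q by rewrite neq_ltn /q ltnS leq_addl.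
have pairE (n1 n2 : nat) : n1 != n2 -> (i, n1) != (i, n2) :> A.
  by rewrite xpair_eqE eqxx.
have rel a b : 0 < a -> 0 < b -> a `^ p i + b `^ p i = 1 ->
    (b * a `^ (p i - 1))%:C%C * (f (i, k) * g (e_ (i, l))) =
    (a * b `^ (p i - 1))%:C%C * conjc (f (i, l) * g (e_ (i, k))).
  move=> a0 b0 ab; have pi0 : 0 < p i by exact: lt_le_trans (hp i).
  apply: (@coefficient_relation _ _ (i, q) a b 0 _ _ 0); rewrite ?powR_ge0 ?pairE//.
  - move=> v e v1 e1; rewrite mulr0 addr0 !mulr_powRB1 ?(ltW a0) ?(ltW b0)// ab.
    rewrite (@sum_norm_single _ _ _ hp _ hN nN _ i); last first.
      move=> n ni; rewrite mul0r trivecE mul0r addr0.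
      have nE (s : nat) : (n == (i, s)) = false.
        by apply/negbTE; apply: contra ni => /eqP ->.
      by rewrite !nE !mulr0 addr0.
    rewrite (@ellnorm_pair _ _ k l)//; last first.
      move=> n nk nl; rewrite /part mul0r trivecE mul0r addr0 !xpair_eqE eqxx /=.
      by rewrite (negbTE nk) (negbTE nl) !mulr0 addr0.
    rewrite /part mul0r !trivecE !mul0r !xpair_eqE !eqxx /= (negbTE kl).
    rewrite [l == k]eq_sym (negbTE kl) !mulr0 !mulr1 !addr0 add0r.
    by rewrite modulusM v1 mulr1 !modulus_real ?(ltW a0) ?(ltW b0)// ab powR1.
  - move=> y Xy; rewrite mul0r addr0.
    apply: le_trans (sum_norm_part p hN nN y i).
    apply: le_trans (part_pair_ge i Xy kl).
    by apply: dual_weight_le => //; rewrite ?modulus_ge0 ?ltW.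
(* Equal weights give [z = w]; unequal ones give a relation whose two coefficients differ by
   [weights_neq], so [z = 0]. *)
have [a [b [a0 b0 ab ab1]]] := thirds_weight (hp i).
have [d [d0 _ d1]] := half_weight (hp i).
have := rel a b a0 b0 ab1; have := rel d d d0 d0 d1.
set z := f _ * _; set w := conjc _.
have dn : (d * d `^ (p i - 1))%:C%C != 0 :> C.
  by rewrite gt_eqF// ltcR mulr_gt0// powR_gt0.
move=> /(mulfI dn) <- /eqP; rewrite -subr_eq0 -mulrBl mulf_eq0 => /orP[|/eqP//].
rewrite -rmorphB fmorph_eq0 subr_eq0.
by rewrite (negbTE (weights_neq (p2 i) a0 b0 ab)).
Qed.

Lemma diff_color_vanish i j (k l : nat) : i != j -> f (i, k) * g (e_ (j, l)) = 0.
Proof.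
move=> ij; pose q := k.+1.
have kq : k != q by rewrite neq_ltn ltnSn.
have [s [t [c [[s0 t0 c0] st1 Nst supp]]]] := anorm_support hN nN ij.
have kl' : (i, k) != (j, l) :> A by rewrite xpair_eqE (negbTE ij).
have lq' : (j, l) != (i, q) :> A by rewrite xpair_eqE eq_sym (negbTE ij).
have kq' : (i, k) != (i, q) :> A by rewrite xpair_eqE eqxx.
have ji : (j == i) = false by rewrite eq_sym (negbTE ij).
have pi0 : 0 < p i by exact: lt_le_trans (hp i).
have pj0 : 0 < p j by exact: lt_le_trans (hp j).
(* The test vector has color-[i] part [s * (a, b)] on [k] and [q], and entry of modulus [t] at
   [(j, l)]. Its norm is [c] for every unit [(a, b)], so [a] can vary while [(s, t)] stays at the
   point where [N] has a known supporting functional. *)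
have rel a b : 0 <= a -> 0 <= b -> a `^ p i + b `^ p i = 1 ->
    (t * (c * a `^ (p i - 1)))%:C%C * (f (i, k) * g (e_ (j, l))) =
    (s * a * c)%:C%C * conjc (f (j, l) * g (e_ (i, k))).
  move=> a0 b0 ab.
  apply: (@coefficient_relation _ _ (i, q) (s * a) t (s * b) _ _ (c * b `^ (p i - 1)));
    rewrite ?mulr_ge0 ?powR_ge0 ?(ltW c0)//.
  - move=> v e v1 e1.
    have -> : s * a * (c * a `^ (p i - 1)) + t * c + s * b * (c * b `^ (p i - 1)) =
        c * (s * (a * a `^ (p i - 1) + b * b `^ (p i - 1)) + t) by ring.
    rewrite !mulr_powRB1// ab mulr1 st1 mulr1 -Nst.
    set x := trivec _ _ _ _ _ _.
    rewrite (@sum_norm_pairE _ _ _ hp _ x i j ij); last first.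
      move=> n ni nj; rewrite /x trivecE.
      have nE h r : color n != h -> (n == (h, r)) = false.
        by move=> nh; apply/negbTE; apply: contra nh => /eqP ->.
      by rewrite !nE// !mulr0 !addr0.
    congr (N (pair_row _ _ _ _)).
      rewrite (@ellnorm_pair _ _ k q)//; last first.
        move=> n nk nq; rewrite /part /x trivecE !xpair_eqE !eqxx (negbTE ij) /=.
        by rewrite (negbTE nk) (negbTE nq) !mulr0 !addr0.
      rewrite /part /x !trivecE !xpair_eqE !eqxx (negbTE ij) /= (negbTE kq).
      rewrite [q == k]eq_sym (negbTE kq) !mulr0 !mulr1 !addr0 !add0r.
      rewrite modulusM e1 mulr1 !modulus_real ?mulr_ge0 ?(ltW s0)//.
      rewrite !powRM ?(ltW s0)// -mulrDr ab mulr1 -powRrM mulfV ?gt_eqF//.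
      by rewrite powRr1 ?ltW.
    have ln : l != l.+1 by rewrite neq_ltn ltnSn.
    rewrite (@ellnorm_pair _ _ l l.+1)//; last first.
      move=> n nl _; rewrite /part /x trivecE !xpair_eqE ji eqxx /=.
      by rewrite (negbTE nl) !mulr0 !addr0.
    rewrite /part /x !trivecE !xpair_eqE !eqxx ji /= [l.+1 == l]eq_sym (negbTE ln).
    rewrite !mulr0 !mulr1 !addr0 !add0r modulus0 powR0 ?gt_eqF// addr0.
    rewrite modulusM v1 mulr1 modulus_real ?(ltW t0)// -powRrM mulfV ?gt_eqF//.
    by rewrite powRr1 ?ltW.
  - move=> y Xy; apply: le_trans (sum_norm_pair p hN y ij).
    apply: le_trans (supp _ _ (ellnorm_ge0 _ _) (ellnorm_ge0 _ _)).
    have := le_modulus_ellnorm (hp j) l (Xy j).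
    have := le_trans (dual_weight_le (hp i) a0 b0 ab (modulus_ge0 (y (i, k)))
      (modulus_ge0 (y (i, q)))) (part_pair_ge i Xy kq).
    rewrite -[part y j l]/(y (j, l)) => h1 h2.
    have := lerD h1 h2; rewrite -(ler_pM2l c0); apply: le_trans.
    by rewrite le_eqVlt; apply/orP; left; apply/eqP; ring.
(* Eliminating [w] between the relations for [(1, 0)] and [(d, d)] leaves
   [(d - d^(p_i - 1)) * z = 0] up to a positive factor, and [d != 1]. *)
have rel1 := rel 1 0 ler01 (lexx 0); rewrite !powR1 powR0 ?gt_eqF// addr0 !mulr1 in rel1.
have [d [d0 dn1 d1]] := half_weight (hp i).
have rel2 := rel d d (ltW d0) (ltW d0) d1.
move: (rel1 erefl) rel2; set z := f _ * _; set w := conjc _ => r1 r2.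
have : (d * (t * c) - t * c * d `^ (p i - 1))%:C%C * z = 0.
  rewrite rmorphB mulrBl; apply/eqP; rewrite subr_eq0; apply/eqP.
  have -> : t * c * d `^ (p i - 1) = t * (c * d `^ (p i - 1)) by ring.
  rewrite r2; transitivity (d%:C%C * ((t * c)%:C%C * z)); first by rewrite rmorphM mulrA.
  by rewrite r1 [in RHS](_ : s * d * c = d * (s * c)) ?rmorphM ?mulrA//; ring.
move/eqP; rewrite mulf_eq0 fmorph_eq0 => /orP[|/eqP//].
rewrite mulrC -mulrBr mulf_eq0 (gt_eqF (mulr_gt0 t0 c0)) /= subr_eq0.
have := weights_neq (p2 i) d0 ltr01 dn1; rewrite powR1 mul1r mulr1 eq_sym.
by move/negbTE ->.
Qed.

Lemma rank_one_vanish k l : k != l -> f k * g (e_ l) = 0.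
Proof.
case: k l => [i k] [j l]; rewrite xpair_eqE negb_and.
have [->|ij _] := eqVneq i j; last exact: diff_color_vanish.
by rewrite /=; exact: same_color_vanish.
Qed.

End RankOne.

(** * Isometries permute the basis and preserve colors *)

Section Isometries.
Local Opaque ellnorm.
Variables (R : realType) (m : nat) (p : 'I_m -> R) (N : 'rV[R]_m -> R).
Hypotheses (hp : forall i, 1 <= p i) (p2 : forall i, p i != 2) (p_inj : injective p).
Hypotheses (hN : absolute_norm N) (nN : normalized N).
Local Notation C := R[i].
Local Notation vect := (vect R m).
Local Notation A := (idx m).
Local Notation X := (sum_ell p).
Local Notation nu := (sum_norm p N).
Local Notation e_ := (@basis_vec R m).
Implicit Types (x y : vect) (k l q : A) (i j : 'I_m) (T : vect -> vect).

Lemma isom_sum_ell T x : Isom p N T -> X x -> X (T x).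
Proof. by move=> [TX _ _] Xx; rewrite -TX; exists x. Qed.

Definition inverse_isoms T Ti := [/\ Isom p N T, Isom p N Ti,
  forall x, X x -> Ti (T x) = x & forall x, X x -> T (Ti x) = x].

Lemma inverse_isoms_sym T Ti : inverse_isoms T Ti -> inverse_isoms Ti T.
Proof. by case. Qed.

(** Injectivity on [X] comes from preservation of the norm, which is definite there; off [X] the
    inverse is arbitrary. *)
Lemma isom_inverse T : Isom p N T -> exists Ti, inverse_isoms T Ti.
Proof.
move=> isoT; have [TX lin iso] := isoT.
have /choice[Ti TiE] : forall y, exists x, X y -> X x /\ T x = y.
  move=> y; have [Xy|nXy] := pselect (X y); last by exists y.
  have : (T @` X) y by rewrite TX.
  by move=> [x Xx <-]; exists x.
have XTi y : X y -> X (Ti y) by move=> /TiE[].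
have TTi y : X y -> T (Ti y) = y by move=> /TiE[].
have T_inj x y : X x -> X y -> T x = T y -> x = y.
  move=> Xx Xy Txy; apply/eqP; rewrite -subr_eq0 addrC -scaleN1r; apply/eqP.
  have Xz : X (-1 *: y + x) by exact: (sum_ell_linear hp).
  apply: (sum_norm_eq0 hp hN nN Xz); rewrite -iso//.
  have -> : T (-1 *: y + x) = 0 by rewrite lin// Txy scaleN1r addNr.
  exact: sum_norm0.
have TiT x : X x -> Ti (T x) = x.
  move=> Xx; have XTx := isom_sum_ell isoT Xx.
  exact: (T_inj _ _ (XTi _ XTx) Xx (TTi _ XTx)).
exists Ti; split; [exact: isoT| | |exact: TTi].
- split=> [|c x y Xx Xy|x Xx].
  + apply/seteqP; split=> [_ [y Xy <-]|x Xx]; first exact: XTi.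
    by exists (T x); [exact: isom_sum_ell|exact: TiT].
  + have Xz := sum_ell_linear hp c Xx Xy.
    apply: (T_inj _ _ (XTi _ Xz) (sum_ell_linear hp c (XTi _ Xx) (XTi _ Xy))).
    by rewrite (TTi _ Xz) (lin _ _ _ (XTi _ Xx) (XTi _ Xy)) (TTi _ Xx) (TTi _ Xy).
  + by rewrite -(iso _ (XTi _ Xx)) (TTi _ Xx).
- exact: TiT.
Qed.

Section Pair.
Variables T Ti : vect -> vect.
Hypothesis TTi : inverse_isoms T Ti.

Definition sends T k l := exists2 c : C, modulus c = 1 & T (e_ k) = c *: e_ l.

Lemma isom0 : T 0 = 0.
Proof.
case: TTi => -[_ lin _] _ _ _; have X0 := sum_ell0 hp; have := lin 1 0 0 X0 X0.
by rewrite !scale1r addr0 => /eqP; rewrite -subr_eq subrr eq_sym => /eqP.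
Qed.

Lemma isom_scale c x : X x -> T (c *: x) = c *: T x.
Proof.
case: TTi => -[_ lin _] _ _ _ Xx.
by rewrite -[c *: x]addr0 (lin _ _ _ Xx (sum_ell0 hp)) isom0 addr0.
Qed.

Lemma coord_linear k : linear_on (F := C^o) X (fun x => T x k).
Proof. by case: TTi => -[_ lin _] _ _ _ c x y Xx Xy; rewrite lin. Qed.

Lemma coord_bounded k x : X x -> modulus (T x k) <= nu x.
Proof.
case: TTi => isoT _ _ _ Xx; have [_ _ iso] := isoT; rewrite -(iso x Xx).
exact: (sum_norm_coord hp hN nN k (isom_sum_ell isoT Xx)).
Qed.

End Pair.

Lemma sum_norm_basis k : nu (e_ k) = 1.
Proof.
rewrite (sum_norm_single hp hN nN (i := color k)); last first.
  by move=> l lk; rewrite /basis_vec (_ : (l == k) = false)//; apply: contraNF lk => /eqP ->.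
case: k => i k; rewrite (@ellnorm_finsupp _ _ (hp i) _ [:: k])//.
  by rewrite big_seq1 /part /basis_vec eqxx modulus1 !powR1.
by move=> l; rewrite inE /part /basis_vec xpair_eqE eqxx /= => /negbTE ->.
Qed.

(** Multiplying coordinate [k] by [lam] preserves the norm; conjugating this by [T] gives the
    rotations required of [f = T (e_ k)] and [g], the [k]-th coordinate of [Ti]. All products
    [f q * g (e_ l)] with [q != l] then vanish. *)
Lemma sends_basis T Ti k : inverse_isoms T Ti -> exists l, sends T k l.
Proof.
move=> TTi; have [isoT isoTi TiT TTiE] := TTi; have [_ lin iso] := isoT.
have Xe l : X (e_ l) := sum_ell_basis hp l.
pose f := T (e_ k); pose g x := Ti x k.
have Xf : X f by exact: isom_sum_ell.
have g_lin : linear_on (F := C^o) X g.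
  exact: (coord_linear (inverse_isoms_sym TTi)).
have rot x lam : X x -> modulus lam = 1 -> nu (x + ((lam - 1) * g x) *: f) = nu x.
  move=> Xx lam1; have XTx := isom_sum_ell isoTi Xx.
  have -> : x + ((lam - 1) * g x) *: f = T (((lam - 1) * g x) *: e_ k + Ti x).
    by rewrite (lin _ _ _ (Xe k) XTx) (TTiE _ Xx) addrC.
  rewrite (iso _ (sum_ell_linear hp _ (Xe k) XTx)).
  have [_ _ isoi] := isoTi; rewrite -[RHS](isoi x Xx).
  apply: eq_sum_norm => l.
  have -> : (((lam - 1) * g x) *: e_ k + Ti x) l = (lam - 1) * g x * (l == k)%:R + Ti x l by [].
  have [->|_] := eqVneq l k; last by rewrite mulr0 add0r.
  by rewrite mulr1 /g mulrBl mul1r subrK modulusM lam1 mul1r.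
have vanish := rank_one_vanish hp p2 hN nN Xf g_lin rot.
have f_neq0 : f <> 0.
  move=> f0; have := sum_norm_basis k; rewrite -(iso _ (Xe k)) -/f f0 sum_norm0//.
  by move/esym/eqP; rewrite oner_eq0.
have [l fl] : exists l, f l != 0.
  apply: contrapT => nl; apply: f_neq0; apply/funext => l.
  by apply: contrapT => /eqP fl; apply: nl; exists l.
have g0 q : q != l -> g (e_ q) = 0.
  move=> ql; have /vanish/eqP : l != q by rewrite eq_sym.
  by rewrite mulf_eq0 (negbTE fl) => /eqP.
(* Otherwise [g] would vanish on every basis vector, hence on [f] by density, whereas [g f] is
   coordinate [k] of [e_ k], that is 1. *)
have gl : g (e_ l) != 0.
  apply/eqP => gl; have : g f = 0.
    apply: (vanishing_functional hp hN nN g_lin) => //.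
      by move=> y Xy; exact: (coord_bounded (inverse_isoms_sym TTi)).
    by move=> q _; have [->//|/g0] := eqVneq q l.
  by rewrite /g /f TiT// /basis_vec eqxx => /eqP; rewrite oner_eq0.
have fE : f = f l *: e_ l.
  apply/funext => q; have -> : (f l *: e_ l) q = f l * (q == l)%:R by [].
  have [->|ql] := eqVneq q l; first by rewrite mulr1.
  have /eqP := vanish _ _ ql; rewrite mulf_eq0 (negbTE gl) orbF mulr0.
  by move/eqP.
exists l, (f l) => //.
have : nu f = 1 by rewrite iso// sum_norm_basis.
rewrite {1}fE (sum_norm_single hp hN nN (i := color l)).
  case: (l) => i n; rewrite (@ellnorm_finsupp _ _ (hp i) _ [:: n]).
  - rewrite big_seq1 -powRrM mulfV ?gt_eqF ?(lt_le_trans ltr01)// powRr1 ?modulus_ge0//.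
    rewrite [part _ _ _](_ : _ = f (i, n) * ((i, n) == (i, n))%:R)//.
    by rewrite eqxx mulr1.
  - by [].
  - move=> r; rewrite inE => /negbTE rn.
    rewrite [part _ _ _](_ : _ = f (i, n) * ((i, r) == (i, n))%:R)//.
    by rewrite xpair_eqE eqxx rn mulr0.
move=> q ql; rewrite [LHS](_ : _ = f l * (q == l)%:R)//.
by rewrite (_ : (q == l) = false) ?mulr0//; apply: contraNF ql => /eqP ->.
Qed.

Lemma sends_sym T Ti k l : inverse_isoms T Ti -> sends T k l -> sends Ti l k.
Proof.
move=> TTi [c c1 TE]; have Xe q : X (e_ q) := sum_ell_basis hp q.
have c0 : c != 0 by apply: contra_eq_neq c1 => ->; rewrite modulus0 eq_sym oner_eq0.
exists c^-1.
  have : modulus (c * c^-1) = 1 by rewrite mulfV// modulus1.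
  by rewrite modulusM c1 mul1r.
have [_ _ TiT _] := TTi; have := TiT _ (Xe k); rewrite TE.
rewrite (isom_scale (inverse_isoms_sym TTi))// => <-.
by rewrite scalerA mulVf// scale1r.
Qed.

Lemma sends_fun T k l q : sends T k l -> sends T k q -> l = q.
Proof.
move=> [c c1 TE] [d _]; rewrite TE => /(congr1 (fun x : vect => x l)).
rewrite -[(c *: _) l]/(c * (l == l)%:R) -[(d *: _) l]/(d * (l == q)%:R) eqxx mulr1.
case: eqVneq => // _; rewrite mulr0 => c0.
by move: c1; rewrite c0 modulus0 => /esym/eqP; rewrite oner_eq0.
Qed.

Lemma sends_inj T Ti k k' l : inverse_isoms T Ti -> sends T k l -> sends T k' l -> k = k'.
Proof.
move=> TTi /(sends_sym TTi) h /(sends_sym TTi); exact: sends_fun.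
Qed.

Lemma sends_sum_norm T Ti k k' l l' : inverse_isoms T Ti -> k != k' ->
  sends T k l -> sends T k' l' -> nu (e_ k + e_ k') = nu (e_ l + e_ l').
Proof.
move=> TTi kk' sk sk'; have ll' : l != l'.
  by apply: contra kk' => /eqP ll'; apply/eqP; move: sk'; rewrite -ll'; exact: sends_inj TTi sk.
have [[_ lin iso] _ _ _] := TTi; have Xe q : X (e_ q) := sum_ell_basis hp q.
case: sk sk' => [c c1 TE] [d d1 TE'].
have := lin 1 _ _ (Xe k) (Xe k'); rewrite !scale1r => Tkk'.
have Xkk' : X (e_ k + e_ k') by rewrite -[e_ k]scale1r; exact: (sum_ell_linear hp).
rewrite -(iso _ Xkk') Tkk' TE TE'; apply: eq_sum_norm => q.
have -> : (c *: e_ l + d *: e_ l') q = c * (q == l)%:R + d * (q == l')%:R by [].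
have -> : (e_ l + e_ l') q = (q == l)%:R + (q == l')%:R by [].
have [->|_] := eqVneq q l.
  by rewrite (negbTE ll') mulr1 mulr0 !addr0 c1 modulus1.
by case: eqVneq => _; rewrite !mulr0 ?mulr1 ?add0r ?addr0// d1 modulus1.
Qed.

Lemma sum_norm_two_same i (k l : nat) : k != l ->
  nu (e_ (i, k) + e_ (i, l)) = 2 `^ (p i)^-1.
Proof.
move=> kl; rewrite (sum_norm_single hp hN nN (i := i)); last first.
  move=> q qi; rewrite [LHS](_ : _ = (q == (i, k))%:R + (q == (i, l))%:R)//.
  have nE (s : nat) : (q == (i, s)) = false by apply: contraNF qi => /eqP ->.
  by rewrite !nE addr0.
have partE s : part (e_ (i, k) + e_ (i, l)) i s = (s == k)%:R + (s == l)%:R.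
  rewrite [LHS](_ : _ = ((i, s) == (i, k))%:R + ((i, s) == (i, l))%:R)//.
  by rewrite !xpair_eqE eqxx.
rewrite (@ellnorm_pair _ _ _ hp _ _ k l)//.
  rewrite !partE !eqxx (negbTE kl) eq_sym (negbTE kl) addr0 add0r modulus1.
  by rewrite !powR1.
by move=> s /negbTE sk /negbTE sl; rewrite partE sk sl addr0.
Qed.

Lemma sum_norm_two_diff i j (k l : nat) : i != j ->
  nu (e_ (i, k) + e_ (j, l)) = N (pair_row i j 1 1).
Proof.
move=> ij; rewrite (@sum_norm_pairE _ _ _ hp _ _ i j ij); last first.
  move=> q qi qj; rewrite [LHS](_ : _ = (q == (i, k))%:R + (q == (j, l))%:R)//.
  have nE h (s : nat) : color q != h -> (q == (h, s)) = false.
    by move=> qh; apply: contraNF qh => /eqP ->.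
  by rewrite !nE// addr0.
have norm1 h (n : nat) (x : vect) :
      (forall s, part x h s = (s == n)%:R) -> ellnorm (p h) (part x h) = 1.
  move=> xE; rewrite (@ellnorm_finsupp _ _ (hp h) _ [:: n])//.
    by rewrite big_seq1 xE eqxx modulus1 !powR1.
  by move=> s; rewrite inE xE => /negbTE ->.
congr (N (pair_row _ _ _ _)).
  apply: (norm1 _ k) => s.
  rewrite [LHS](_ : _ = ((i, s) == (i, k))%:R + ((i, s) == (j, l))%:R)//.
  by rewrite !xpair_eqE eqxx (negbTE ij) addr0.
apply: (norm1 _ l) => s.
rewrite [LHS](_ : _ = ((j, s) == (i, k))%:R + ((j, s) == (j, l))%:R)//.
by rewrite !xpair_eqE eqxx [j == i]eq_sym (negbTE ij) add0r.
Qed.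

Lemma two_powR_inj i j : 2 `^ (p i)^-1 = 2 `^ (p j)^-1 :> R -> i = j.
Proof.
move/(congr1 (@ln R)); rewrite !ln_powR => /mulIf h.
apply/p_inj/invr_inj/h; rewrite gt_eqF// ln_gt0//; lra.
Qed.

Lemma sends_same_color T Ti i j (k k' l l' : nat) : inverse_isoms T Ti -> k != k' ->
  sends T (i, k) (j, l) -> sends T (i, k') (j, l') -> i = j.
Proof.
move=> TTi kk' sk sk'; apply: two_powR_inj.
have kk2 : (i, k) != (i, k') :> A by rewrite xpair_eqE eqxx.
rewrite -(sum_norm_two_same i kk') (sends_sum_norm TTi kk2 sk sk').
apply: sum_norm_two_same; apply: contra kk2 => /eqP ll'.
by apply/eqP; move: sk'; rewrite -ll'; exact: sends_inj TTi sk.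
Qed.

(* By the pigeonhole principle some coordinate of color [i] keeps its color. *)
Lemma sends_diff_color T Ti i j (k l : nat) : inverse_isoms T Ti -> i != j ->
  sends T (i, k) (j, l) -> N (pair_row j i 1 1) = 2 `^ (p i)^-1.
Proof.
move=> TTi ij sk.
have /choice[pi piE] := fun q => sends_basis q TTi.
pose h (s : 'I_m.+1) := color (pi (i, s : nat)).
have [s [s' [ss' hss']]] : exists s s', s != s' /\ h s = h s'.
  apply: contrapT => nss'; have h_inj : injective h.
    move=> s s' hs; apply: contrapT => /eqP ss'; apply: nss'; by exists s, s'.
  by have := leq_card _ h_inj; rewrite !card_ord ltnn.
have si := piE (i, s : nat); have si' := piE (i, s' : nat).
have hsi : h s = i.
  move: si si' hss'; rewrite /h; case: (pi (i, s : nat)) => a b.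
  case: (pi (i, s' : nat)) => a' b' /= sa sa' aa'; rewrite -aa' in sa'.
  by apply/esym/(sends_same_color TTi _ sa sa').
move: si hsi; rewrite /h; case: (pi (i, s : nat)) => a b /= sa ai; rewrite ai in sa.
(* One coordinate of color [i] keeps its color and another moves to [j]; the norm of their sum is
   [2^(1/p_i)] before [T] and [N (e_j + e_i)] after. *)
have ks : k != s.
  apply: contra ij => /eqP ks; move: sk; rewrite ks => sk.
  by have [->] := sends_fun sa sk.
rewrite -(sum_norm_two_same i ks) (sends_sum_norm TTi _ sk sa) ?xpair_eqE ?eqxx//.
by rewrite sum_norm_two_diff// eq_sym.
Qed.

Lemma sends_color T Ti k l : inverse_isoms T Ti -> sends T k l -> color l = color k.
Proof.
move: k l => [i k] [j l] TTi sk /=; apply/eqP; rewrite eq_sym; apply/negPn/negP => ij.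
have := sends_diff_color TTi ij sk.
have ji : j != i by rewrite eq_sym.
rewrite [LHS](_ : _ = N (pair_row i j 1 1)); last by rewrite /pair_row addrC.
rewrite (sends_diff_color (inverse_isoms_sym TTi) ji (sends_sym TTi sk)).
by move/two_powR_inj => ji'; rewrite ji' eqxx in ij.
Qed.

(** Each coordinate of [T x] of color [i] is a bounded functional of [x] that kills basis vectors of
    other colors, so density applies. *)
Lemma isom_vanish T Ti i x : inverse_isoms T Ti -> X x -> part x i = 0 -> part (T x) i = 0.
Proof.
move=> TTi Xx xi; apply/funext => l.
apply: (vanishing_functional hp hN nN (coord_linear TTi (i, l)) _ Xx).
  exact: (coord_bounded TTi (i, l)).
move=> k xk; have [q sq] := sends_basis k TTi.
have kq := sends_color TTi sq; case: sq => c _ ->.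
rewrite -[LHS]/(c * ((i, l) == q)%:R); have [iq|_] := eqVneq (i, l) q; last by rewrite mulr0.
case/eqP: xk; case: k kq => j k; rewrite -iq /= => ij.
by rewrite -ij -[LHS]/(part x i k) xi.
Qed.

Lemma isom_part T Ti i x : inverse_isoms T Ti -> X x ->
  part (T x) i = part (T (inj_vec i (part x i))) i.
Proof.
move=> TTi Xx; have [[_ lin _] _ _ _] := TTi.
have Xi : X (inj_vec i (part x i)) by exact: (sum_ell_inj hp (Xx i)).
have Xd : X (-1 *: inj_vec i (part x i) + x) by exact: (sum_ell_linear hp).
have := isom_vanish (i := i) TTi Xd; rewrite lin// => h.
have {h} : part (-1 *: T (inj_vec i (part x i)) + T x) i = 0.
  apply: h; apply/funext => l.
  rewrite -[LHS]/(-1 * inj_vec i (part x i) (i, l) + x (i, l)) /inj_vec eqxx.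
  by rewrite mulN1r addNr.
move=> h; apply/funext => l; have := congr1 (fun f : nat -> C => f l) h.
rewrite -[X in X = _ -> _]/(-1 * T (inj_vec i (part x i)) (i, l) + T x (i, l)).
by rewrite mulN1r => /eqP; rewrite addrC subr_eq0 => /eqP.
Qed.

Lemma isom_inj_vec T Ti i f : inverse_isoms T Ti -> ell [set: nat] (p i) f ->
  T (inj_vec i f) = inj_vec i (part (T (inj_vec i f)) i).
Proof.
move=> TTi fX; have Xf := sum_ell_inj hp fX; apply/funext => -[j l].
rewrite {2}/inj_vec /=; case: eqVneq => [->//|ji].
have /(congr1 (fun h : nat -> C => h l)) := isom_vanish (i := j) TTi Xf (part_inj_vec_neq f ji).
by [].
Qed.

Lemma isom_prod_isom : Isom p N `<=` prod_Isom p.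
Proof.
move=> T isoT; have [Ti TTi] := isom_inverse isoT.
have [_ isoTi TiT TTiE] := TTi; have [_ lin iso] := isoT.
exists (fun i f => part (T (inj_vec i f)) i); split; last first.
  by move=> x Xx i; exact: (isom_part i TTi Xx).
move=> i; split=> [|c f h fX hX|f fX].
- apply/seteqP; split=> [_ [f fX <-]|h hX].
    exact: (isom_sum_ell isoT (sum_ell_inj hp fX)).
  have Xh := sum_ell_inj hp hX.
  exists (part (Ti (inj_vec i h)) i); first exact: (isom_sum_ell isoTi Xh).
  rewrite -(isom_inj_vec (inverse_isoms_sym TTi) hX) (TTiE _ Xh).
  exact: part_inj_vec.
- have := lin c _ _ (sum_ell_inj hp fX) (sum_ell_inj hp hX) => /(congr1 (fun x => part x i)).
  have -> : c *: inj_vec i f + inj_vec i h = inj_vec i (c *: f + h).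
    apply/funext => -[j l]; rewrite -[LHS]/(c * inj_vec i f (j, l) + inj_vec i h (j, l)).
    rewrite /inj_vec /=; case: ifP => // _; by rewrite mulr0 addr0.
  by [].
- rewrite -(sum_norm_inj hp hN nN i) -(isom_inj_vec TTi fX).
  by rewrite (iso _ (sum_ell_inj hp fX)) (sum_norm_inj hp hN nN).
Qed.

Lemma prod_isom_isom : prod_Isom p `<=` Isom p N.
Proof.
move=> T [U [isoU TU]].
have XT x : X x -> X (T x).
  move=> Xx i; rewrite (TU _ Xx); have [UX _ _] := isoU i.
  by rewrite -UX; exists (part x i).
have vect_ext x y : (forall i, part x i = part y i) -> x = y.
  by move=> xy; apply/funext => -[i l]; exact: (congr1 (fun h : nat -> C => h l) (xy i)).
split=> [|c x y Xx Xy|x Xx].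
- apply/seteqP; split=> [_ [x Xx <-]|y Xy]; first exact: XT.
  have /choice[h hE] : forall i, exists h, ell [set: nat] (p i) h /\ U i h = part y i.
    move=> i; have [UX _ _] := isoU i.
    have : (U i @` ell [set: nat] (p i)) (part y i) by rewrite UX.
    by move=> [h hX <-]; exists h.
  pose x : vect := fun k => h (color k) k.2.
  have Xx : X x by move=> i; exact: (hE i).1.
  by exists x; [exact: Xx|apply: vect_ext => i]; rewrite (TU _ Xx); exact: (hE i).2.
- have Xz : X (c *: x + y) by exact: (sum_ell_linear hp).
  apply: vect_ext => i; rewrite (TU _ Xz).
  have [_ Ulin _] := isoU i.
  by have := Ulin c _ _ (Xx i) (Xy i); rewrite -(TU _ Xx) -(TU _ Xy).
- have normE : (fun i => ellnorm (p i) (part (T x) i)) = (fun i => ellnorm (p i) (part x i)).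
    by apply/funext => i; rewrite (TU _ Xx); have [_ _ Uiso] := isoU i; exact: (Uiso _ (Xx i)).
  exact: (congr1 (fun a : 'I_m -> R => N (\row_i a i)) normE).
Qed.

Lemma Isom_prod_Isom : Isom p N = prod_Isom p.
Proof. by apply/seteqP; split; [exact: isom_prod_isom|exact: prod_isom_isom]. Qed.

End Isometries.

(** * Invariance of the strata *)

Section Stratification.
Local Opaque ellnorm.
Variables (R : realType) (m n : nat) (p : 'I_m -> R) (N : 'rV[R]_m -> R).
Hypotheses (hp : forall i, 1 <= p i) (p2 : forall i, p i != 2) (p_inj : injective p).
Hypotheses (hN : absolute_norm N) (nN : normalized N).
Local Notation C := R[i].
Local Notation vect := (vect R m).
Local Notation X := (sum_ell p).
Implicit Types (x y : vect) (T : vect -> vect) (V W : set vect).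

Lemma isom_comb T Ti d (c : 'I_d -> C) (v : 'I_d -> vect) : inverse_isoms p N T Ti ->
  (forall r, X (v r)) -> T (\sum_r c r *: v r) = \sum_r c r *: T (v r).
Proof.
move=> TTi Xv; have [[_ lin _] _ _ _] := TTi.
suff [] : X (\sum_r c r *: v r) /\ T (\sum_r c r *: v r) = \sum_r c r *: T (v r) by [].
elim/big_rec2: _ => [|r y x _ [Xx Tx]].
  split; first exact: (sum_ell0 hp).
  exact: (isom0 hp TTi).
split; first exact: (sum_ell_linear hp _ (Xv r) Xx).
by rewrite (lin _ _ _ (Xv r) Xx) Tx.
Qed.

Lemma basis_mem (E : lmodType C) d (v : 'I_d -> E) (V : set E) r : is_basis v V -> V (v r).
Proof.
move=> [_ <-]; exists (fun s => (s == r)%:R).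
rewrite (bigD1 r)//= eqxx scale1r big1 ?addr0// => s /negbTE ->.
by rewrite scale0r.
Qed.

Lemma has_dim_isom T Ti V d : inverse_isoms p N T Ti -> V `<=` X -> has_dim V d ->
  has_dim (T @` V) d.
Proof.
move=> TTi VX [v hv]; have Xv r : X (v r) by apply: VX; exact: basis_mem hv.
have Tv c := isom_comb c TTi Xv; have [v_ind v_span] := hv.
have Vc c : V (\sum_r c r *: v r) by rewrite -v_span; exists c.
exists (fun r => T (v r)); split.
  move=> c; rewrite -Tv => Tc0; apply: v_ind.
  have [_ _ TiT _] := TTi; rewrite -(TiT _ (VX _ (Vc c))) Tc0.
  exact: (isom0 hp (inverse_isoms_sym TTi)).
apply/seteqP; split=> x.
  by move=> [c ->]; exists (\sum_r c r *: v r); [exact: Vc|exact: Tv].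
by move=> [y]; rewrite -{1}v_span => -[c ->] <-; exists c; exact: Tv.
Qed.

Lemma summand_proj_isom T Ti S x : inverse_isoms p N T Ti -> X x ->
  summand_proj S (T x) = T (summand_proj S x).
Proof.
move=> TTi Xx.
have XS : X (summand_proj S x).
  apply: (sum_ell_dominated hp Xx) => k; rewrite /summand_proj.
  by case: ifP => // _; rewrite modulus0 modulus_ge0.
apply/funext => -[i l]; rewrite {1}/summand_proj /=.
rewrite -[RHS]/(part (T (summand_proj S x)) i l); case: ifPn => iS.
  have partE : part (summand_proj S x) i = part x i.
    apply/funext => k; rewrite -[LHS]/(summand_proj S x (i, k)).
    by rewrite /summand_proj iS.
  rewrite -[LHS]/(part (T x) i l) (isom_part hp p2 p_inj hN nN i TTi Xx).
  by rewrite (isom_part hp p2 p_inj hN nN i TTi XS) partE.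
have part0 : part (summand_proj S x) i = 0.
  apply/funext => k; rewrite -[LHS]/(summand_proj S x (i, k)).
  by rewrite /summand_proj (negbTE iS).
by rewrite (isom_vanish hp p2 p_inj hN nN TTi XS part0).
Qed.

Lemma Gr_isom T Ti V : inverse_isoms p N T Ti -> Gr n p V -> Gr n p (T @` V).
Proof.
move=> TTi [Vn VX]; split; first exact: (has_dim_isom TTi VX Vn).
have [isoT _ _ _] := TTi.
by move=> _ [x Vx <-]; exact: (isom_sum_ell isoT (VX _ Vx)).
Qed.

Lemma polytope_isom T Ti V : inverse_isoms p N T Ti -> Gr n p V ->
  polytope n (T @` V) = polytope n V.
Proof.
move=> TTi [[v hv] VX].
suff dimE S : subspace_dim (summand_proj S @` (T @` V)) = subspace_dim (summand_proj S @` V).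
  by apply/seteqP; split=> a [a0 an aS]; split=> // S; have := aS S; rewrite dimE.
have dS := has_dim_proj hv S.
rewrite (subspace_dimE dS); apply: subspace_dimE.
have -> : summand_proj S @` (T @` V) = T @` (summand_proj S @` V).
  rewrite !image_comp; apply: eq_imagel => x Vx /=.
  exact: (summand_proj_isom S TTi (VX _ Vx)).
apply: (has_dim_isom TTi _ dS) => _ [x Vx <-].
apply: (sum_ell_dominated hp (VX _ Vx)) => k; rewrite /summand_proj.
by case: ifP => // _; rewrite modulus0 modulus_ge0.
Qed.

Lemma face_stratification_isom T S : Isom p N T -> face_stratification n p S ->
  [set T @` W | W in S] = S.
Proof.
move=> isoT [V0 _ <-]; have [Ti TTi] := isom_inverse hp hN nN isoT.
have stable U Ui W : inverse_isoms p N U Ui -> stratum n p (polytope n V0) W ->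
    stratum n p (polytope n V0) (U @` W).
  move=> UUi [GW PW]; split; first exact: (Gr_isom UUi).
  by rewrite (polytope_isom UUi).
apply/seteqP; split=> [_ [W SW <-]|W SW]; first exact: stable TTi SW.
exists (Ti @` W); first exact: stable (inverse_isoms_sym TTi) SW.
have [_ _ _ TTiE] := TTi; have [[_ WX] _] := SW.
rewrite image_comp -[RHS]image_id; apply: eq_imagel => x Wx /=.
exact: TTiE (WX _ Wx).
Qed.

End Stratification.

(** * The global exponent *)

Section FiniteSums.
Variable R : realType.

Lemma sum_by_class (J : eqType) (K : eqType) (h : J -> K) (q : seq J) (F : J -> R) :
  \sum_(x <- q) F x = \sum_(k <- undup (map h q)) \sum_(x <- q | h x == k) F x.
Proof.
rewrite (exchange_big_dep xpredT)//=; apply: eq_big_seq => x xq.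
rewrite big_const_seq /= (eq_count (a2 := pred1 (h x))); last by move=> k; rewrite /= eq_sym.
by rewrite count_uniq_mem ?undup_uniq// mem_undup map_f//= addr0.
Qed.

(** Distinct words of length [n] are among the terms of the expanded [n]-th power of the sum of [H].
    The induction groups them by first letter, through [ohead] so that no default letter is
    needed. *)
Lemma sum_words_le (J : choiceType) (H : J -> R) (B : R) (n : nat) (q : seq (seq J)) :
  (forall k, 0 <= H k) -> 0 <= B ->
  (forall s : seq J, uniq s -> \sum_(k <- s) H k <= B) ->
  uniq q -> (forall w, w \in q -> size w = n) ->
  \sum_(w <- q) \prod_(k <- w) H k <= B ^+ n.
Proof.
move=> H0 B0 HB; elim: n q => [|n IH] q uq qn.
  case: q uq qn => [|w q] /= uq qn; first by rewrite big_nil ler01.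
  have w0 : w = [::] by apply/size0nil/qn; rewrite inE eqxx.
  case: q uq qn => [|w' q] /= uq qn; first by rewrite big_seq1 w0 big_nil.
  move: uq; rewrite inE negb_or => /andP[/andP[/eqP ww' _] _].
  by case: ww'; rewrite w0; apply/esym/size0nil/qn; rewrite !inE eqxx orbT.
rewrite (sum_by_class (@ohead J)).
have inner (k : option J) : \sum_(w <- q | ohead w == k) \prod_(l <- w) H l <=
    oapp H 0 k * B ^+ n.
  case: k => [k|] /=; last first.
    rewrite mul0r big_seq_cond big1// => w /andP[/qn]; by case: w.
  rewrite (_ : \sum_(w <- q | _) _ =
      \sum_(w <- [seq behead w | w <- q & ohead w == Some k]) H k * \prod_(l <- w) H l).
    rewrite -mulr_sumr ler_wpM2l//; apply: IH.
      rewrite map_inj_in_uniq ?filter_uniq// => -[|a w] [|b J']; rewrite !mem_filter //=.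
      by move=> /andP[/eqP[->] _] /andP[/eqP[->] _] ->.
    move=> w /mapP[J']; rewrite mem_filter => /andP[_ /qn] sJ ->.
    by rewrite size_behead sJ.
  rewrite big_map big_filter big_seq_cond [RHS]big_seq_cond.
  apply: eq_bigr => -[|a w] /andP[_] //= /eqP[->].
  by rewrite big_cons.
apply: le_trans (ler_sum _ (fun k _ => inner k)) _.
rewrite -mulr_suml exprS ler_wpM2r ?exprn_ge0//.
set s := undup _.
rewrite (_ : \sum_(k <- s) _ = \sum_(k <- pmap id s) H k).
  by apply: HB; apply: pmap_uniq (undup_uniq _) => x; case: x.
elim: s => [|[k|] s IHs] /=; rewrite ?big_nil// !big_cons ?IHs//=.
by rewrite add0r.
Qed.

End FiniteSums.

Section PluckerSummable.
Variables (R : realType).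
Local Notation C := R[i].

(** Every single term is at most the bound [M] on partial sums, so the surplus power [s / r - 1]
    costs only the factor [M^(s/r - 1)]. *)
Lemma ell_mono (J : choiceType) (D : set J) (r s : R) (f : J -> C) : 0 < r -> r <= s ->
  ell D r f -> ell D s f.
Proof.
move=> r0 rs /ellP[M hM]; apply/ellP.
have sE : s = r * (s / r) by field; rewrite gt_eqF.
have th1 : 1 <= s / r by rewrite ler_pdivlMr// mul1r.
exists (M * M `^ (s / r - 1)) => q uq qD.
have M0 : 0 <= M by have := hM [::] isT; rewrite big_nil; apply.
apply: (@le_trans _ _ (\sum_(k <- q) modulus (f k) `^ r * M `^ (s / r - 1))); last first.
  by rewrite -mulr_suml ler_wpM2r ?powR_ge0// hM.
rewrite big_seq [leRHS]big_seq; apply: ler_sum => k kq.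
rewrite {1}sE powRrM -mulr_powRB1 ?powR_ge0//; last by apply: lt_le_trans th1.
rewrite ler_wpM2l ?powR_ge0//; apply: ge0_ler_powR; rewrite ?nnegrE ?powR_ge0 ?subr_ge0//.
have := hM [:: k] isT; rewrite big_seq1; apply=> l; rewrite inE => /eqP ->.
exact: qD.
Qed.

Lemma modulus_sum_le (I : Type) (r : seq I) (P : pred I) (F : I -> C) :
  modulus (\sum_(i <- r | P i) F i) <= \sum_(i <- r | P i) modulus (F i).
Proof.
elim/big_rec2: _ => [|i x y _ h]; first by rewrite modulus0.
by apply: le_trans (ler_modulusD _ _) _; rewrite lerD2l.
Qed.

Lemma modulus_prod (I : Type) (r : seq I) (P : pred I) (F : I -> C) :
  modulus (\prod_(i <- r | P i) F i) = \prod_(i <- r | P i) modulus (F i).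
Proof.
elim/big_rec2: _ => [|i x y _ h]; first exact: modulus1.
by rewrite modulusM h.
Qed.

Lemma powR_prod (I : Type) (r : seq I) (F : I -> R) (s : R) : (forall i, 0 <= F i) ->
  (\prod_(i <- r) F i) `^ s = \prod_(i <- r) F i `^ s.
Proof.
move=> F0; elim: r => [|i r IH]; first by rewrite !big_nil powR1.
by rewrite !big_cons powRM ?prodr_ge0// IH.
Qed.

Variables (m n : nat) (p : 'I_m -> R).
Hypothesis hp : forall i, 1 <= p i.

Lemma plucker_ell (v : 'I_n -> vect R m) (s : R) : 0 < s -> (forall i, p i <= s) ->
  (forall r, sum_ell p (v r)) -> all_plucker_ell v s.
Proof.
move=> s0 ps Xv; pose H k := \sum_r modulus (v r k) `^ s.
have H0 k : 0 <= H k by apply: sumr_ge0 => r _; exact: powR_ge0.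
have [B B0 HB] : exists2 B, 0 <= B & forall q : seq (idx m), uniq q -> \sum_(k <- q) H k <= B.
  have /choice[M hM] : forall ri : 'I_n * 'I_m, exists M : R, forall q : seq nat, uniq q ->
      (forall k, k \in q -> [set: nat] k) ->
      \sum_(k <- q) modulus (part (v ri.1) ri.2 k) `^ s <= M.
    move=> [r i] /=; apply/(ellP [set: nat] s (part (v r) i)).
    by apply: (ell_mono _ (ps i) (Xv r i)); exact: lt_le_trans (hp i).
  have M0 ri : 0 <= M ri by have := hM ri [::] isT; rewrite big_nil; apply.
  exists (\sum_r \sum_i M (r, i)).
    by apply: sumr_ge0 => r _; apply: sumr_ge0.
  move=> q uq; rewrite /H exchange_big/=; apply: ler_sum => r _.
  rewrite (partition_big (fun k : idx m => color k) xpredT)//=; apply: ler_sum => i _.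
  have uK : uniq [seq k.2 | k <- q & color k == i].
    rewrite map_inj_in_uniq ?filter_uniq// => -[a b] [a' b']; rewrite !mem_filter /=.
    by move=> /andP[/eqP -> _] /andP[/eqP -> _] ->.
  have := hM (r, i) _ uK (fun _ _ => Logic.I).
  rewrite big_map big_filter /=; apply: le_trans.
  rewrite le_eqVlt; apply/orP; left; apply/eqP; apply: eq_bigr => -[a b] /= /eqP ->.
  by [].
apply/ellP; exists ((n`!)%:R `^ s * B ^+ n) => q uq _.
apply: (@le_trans _ _ (\sum_(I <- q) (n`!)%:R `^ s * \prod_(k <- I) H k)); last first.
  rewrite -mulr_sumr ler_wpM2l ?powR_ge0//.
  rewrite -(big_map (@tval n (idx m)) xpredT (fun I : seq (idx m) => \prod_(k <- I) H k)).
  apply: sum_words_le => //; first by rewrite map_inj_uniq//; exact: val_inj.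
  by move=> _ /mapP[I _ ->]; rewrite size_tuple.
(* [M k] dominates every entry of column [k], whichever row is used, so all [n!] Leibniz terms share
   the bound [\prod_(k <- I) M k]. *)
apply: ler_sum => I _; pose M k := H k `^ s^-1.
have vM r k : modulus (v r k) <= M k.
  rewrite -[leLHS]powRr1 ?modulus_ge0// -[X in _ `^ X](@mulfV _ s) ?gt_eqF// powRrM.
  apply: ge0_ler_powR; rewrite ?nnegrE ?invr_ge0 ?powR_ge0 ?(ltW s0)//.
  by rewrite /H (bigD1 r)//= lerDl; apply: sumr_ge0 => ? _; exact: powR_ge0.
have detM : modulus (plucker v I) <= (n`!)%:R * \prod_(k <- I) M k.
  rewrite /plucker /determinant; apply: le_trans (modulus_sum_le _ _ _) _.
  apply: (@le_trans _ _ (\sum_(sg : 'S_n) \prod_(k <- I) M k)); last first.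
    by rewrite sumr_const card_Sn mulr_natl.
  apply: ler_sum => sg _; rewrite modulusM.
  have -> : modulus ((-1) ^+ sg : C) = 1.
    by case: (odd_perm sg); rewrite ?expr1 ?expr0 ?modulusN modulus1.
  rewrite mul1r modulus_prod big_tuple [leRHS](reindex_inj (@perm_inj _ sg))/=.
  by apply: ler_prod => r _; rewrite modulus_ge0 mxE vM.
apply: le_trans (_ : _ <= ((n`!)%:R * \prod_(k <- I) M k) `^ s) _.
  apply: ge0_ler_powR => //; rewrite ?nnegrE ?modulus_ge0 ?(ltW s0)//.
  by rewrite mulr_ge0// prodr_ge0// => k _; exact: powR_ge0.
rewrite powRM ?prodr_ge0 ?ler0n//; last by move=> k _; exact: powR_ge0.
rewrite powR_prod; last by move=> k; exact: powR_ge0.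
rewrite le_eqVlt; apply/orP; left; apply/eqP; congr (_ * _); apply: eq_bigr => k _.
by rewrite -powRrM mulVf ?gt_eqF// powRr1.
Qed.

End PluckerSummable.

(** * A summable sequence with no smaller summable power *)

Section DyadicSequence.
Variable R : realType.

(* Constant on the dyadic blocks [2^L <= k+1 < 2^(L+1)], where its sum is the
   telescoping term [1/((L+1)(L+2))]; hence summable, with no smaller power
   summable. *)
Definition dyadic_seq (k : nat) : R :=
  let L := trunc_log 2 k.+1 in ((2 ^ L * (L.+1 * L.+2))%:R)^-1.

Definition dyadic_block (L : nat) : seq nat := iota (2 ^ L).-1 (2 ^ L).

Lemma dyadic_seq_gt0 k : 0 < dyadic_seq k.
Proof. by rewrite invr_gt0 ltr0n !muln_gt0 expn_gt0. Qed.

Lemma dyadic_blockE L k : k \in dyadic_block L ->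
  dyadic_seq k = ((2 ^ L * (L.+1 * L.+2))%:R)^-1.
Proof.
rewrite mem_iota => /andP[h1 h2]; rewrite /dyadic_seq (_ : trunc_log 2 k.+1 = L)//.
apply: trunc_log_eq => //; have : (0 < 2 ^ L)%N by rewrite expn_gt0.
by rewrite expnS; lia.
Qed.

Lemma sum_dyadic_block L (F : nat -> R) c : (forall k, k \in dyadic_block L -> F k = c) ->
  \sum_(k <- dyadic_block L) F k = (2 ^ L)%:R * c.
Proof.
move=> Fc; rewrite big_seq (eq_bigr (fun=> c))// -big_seq big_const_seq count_predT size_iota.
by rewrite iter_addr_0 mulr_natl.
Qed.

Lemma sum_dyadic L : \sum_(k <- iota 0 (2 ^ L).-1) dyadic_seq k = 1 - (L.+1)%:R^-1.
Proof.
elim: L => [|L IH]; first by rewrite big_nil invr1 subrr.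
have -> : (2 ^ L.+1).-1 = ((2 ^ L).-1 + 2 ^ L)%N.
  have : (0 < 2 ^ L)%N by rewrite expn_gt0.
  by rewrite expnS; lia.
rewrite iotaD big_cat/= IH add0n -/(dyadic_block L).
rewrite (sum_dyadic_block (@dyadic_blockE L)) !natrM -[L.+2%:R]natr1 -[L.+1%:R]natr1.
have : (2 ^ L)%:R != 0 :> R by rewrite pnatr_eq0 expn_eq0.
have : 0 <= L%:R :> R by [].
move: (2 ^ L)%:R L%:R => x y y0 x0; field.
by rewrite x0 /=; apply/andP; split; rewrite gt_eqF//; lra.
Qed.

Lemma dyadic_seq_summable (q : seq nat) : uniq q -> \sum_(k <- q) dyadic_seq k <= 1.
Proof.
move=> uq; pose L := \max_(k <- q) k.+1.
apply: (@le_trans _ _ (\sum_(k <- iota 0 (2 ^ L).-1) dyadic_seq k)); last first.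
  by rewrite sum_dyadic gerBl invr_ge0.
have sub k : k \in q -> k \in iota 0 (2 ^ L).-1.
  move=> kq; rewrite mem_iota /= add0n.
  have : (k.+1 <= L)%N by exact: (@leq_bigmax_seq _ q xpredT (fun k => k.+1) k kq isT).
  by have := ltn_expl L (isT : 1 < 2)%N; lia.
have pq : perm_eq [seq k <- iota 0 (2 ^ L).-1 | k \in q] q.
  apply: uniq_perm => //; first by rewrite filter_uniq// iota_uniq.
  by move=> k; rewrite mem_filter; case: (boolP (k \in q)) => // /sub ->.
rewrite -(perm_big _ pq) /= big_filter [leRHS](bigID (mem q))/= lerDl.
by apply: sumr_ge0 => k _; exact: ltW (dyadic_seq_gt0 k).
Qed.

Lemma dyadic_seq_powR_unbounded (th M : R) : 0 < th -> th < 1 ->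
  exists L, M < \sum_(k <- dyadic_block L) dyadic_seq k `^ th.
Proof.
move=> th0 th1; pose a : R := (1 - th) * ln 2.
have a0 : 0 < a by rewrite mulr_gt0 ?ln_gt0//; lra.
have a30 : 0 < a ^+ 3 by rewrite exprn_gt0.
(* The block sum is at least [exp (L a) / K] with [K = (L+1)(L+2) <= 6 L^2], valid for [L >= 1]. The
   cubic term [(L a)^3 / 3!] of the exponential then yields [L a^3 / 36], where [36 = 6 * 6]. *)
have [L [L0 LM]] : exists L : nat, (0 < L)%N /\ 36 * `|M| / a ^+ 3 < L%:R.
  exists (Num.bound (36 * `|M| / a ^+ 3)).+1; split=> //.
  apply: lt_le_trans (archi_boundP _) _; last by rewrite ler_nat.
  by apply: divr_ge0; [exact: mulr_ge0|exact: ltW].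
exists L.
have dE k : k \in dyadic_block L ->
    dyadic_seq k `^ th = ((2 ^ L * (L.+1 * L.+2))%:R)^-1 `^ th.
  by move=> /dyadic_blockE ->.
rewrite (sum_dyadic_block dE) natrM invfM.
set x : R := (2 ^ L)%:R; set K : R := (L.+1 * L.+2)%:R.
have x0 : 0 < x by rewrite ltr0n expn_gt0.
have K1 : 1 <= K by rewrite /K ler1n muln_gt0.
have K6 : K <= 6 * L%:R ^+ 2 by rewrite /K -natrX -natrM ler_nat; nia.
have lnx : ln x = L%:R * ln 2 by rewrite /x natrX lnXn// mulr_natl.
move: x K x0 K1 K6 lnx => x K x0 K1 K6 lnx.
have K0 : 0 < K by exact: lt_le_trans ltr01 K1.
have KV : K^-1 <= K^-1 `^ th.
  by apply: ger1_powR; rewrite ?invr_gt0 ?K0 ?invf_le1//= ltW.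
have xE : x * x^-1 `^ th = expR (L%:R * a).
  rewrite {1}(_ : x = expR (ln x)); last by rewrite lnK.
  rewrite /powR gt_eqF ?invr_gt0// lnV// -expRD lnx /a; congr expR; ring.
have La0 : 0 <= L%:R * a by rewrite mulr_ge0 ?(ltW a0).
have := expR_ge1Dxn 2 La0; rewrite (_ : 3`!%:R = 6 :> R)// => cube.
rewrite powRM ?invr_ge0 ?ltW// mulrA xE.
apply: lt_le_trans (_ : _ < L%:R * a ^+ 3 / 36) _.
  rewrite ltr_pdivlMr// -ltr_pdivrMr//; apply: le_lt_trans LM.
  by rewrite ler_pM2r ?invr_gt0// [M * _]mulrC ler_pM2l// ler_norm.
apply: le_trans (_ : _ <= expR (L%:R * a) * K^-1) _; last first.
  by rewrite ler_wpM2l ?expR_ge0.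
rewrite ler_pdivlMr//; apply: le_trans (_ : _ <= (L%:R * a) ^+ 3 / 6) _; last by lra.
apply: le_trans (_ : _ <= L%:R * a ^+ 3 / 36 * (6 * L%:R ^+ 2)) _.
  apply: ler_wpM2l K6; apply: divr_ge0 => //; apply: mulr_ge0 => //.
  exact: ltW.
by rewrite le_eqVlt; apply/orP; left; apply/eqP; field.
Qed.

End DyadicSequence.

(** * Sharpness of the exponent at a pure corner *)

Section PureCorner.
Variables (R : realType) (m n : nat) (p : 'I_m -> R).
Hypothesis hp : forall i, 1 <= p i.
Local Notation C := R[i].
Variable i : 'I_m.

Let p0 : 0 < p i. Proof. exact: lt_le_trans ltr01 (hp i). Qed.

Let u (l : nat) : R := dyadic_seq R l `^ (p i)^-1.

Let u_gt0 l : 0 < u l. Proof. exact: powR_gt0 (dyadic_seq_gt0 R l). Qed.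

(* The standard vectors of color [i], the last one being replaced by a vector of
   [l^{p_i}] that belongs to no smaller [l^t]. *)
Definition corner_frame (r : 'I_n.+1) : vect R m :=
  if (r < n)%N then basis_vec R (i, r : nat)
  else inj_vec i (fun l => if (l < n)%N then 0 else (u (l - n))%:C%C).

(** Chosen so that the minor of [corner_frame] is diagonal with entries 1 and finally [u l]: these
    Plücker coordinates reproduce the sequence [u]. The frame has [n.+1] vectors, and [u] is shifted
    by [n] to avoid the standard ones. *)
Definition corner_index (l : nat) : n.+1.-tuple (idx m) :=
  [tuple (i, if (s < n)%N then s : nat else (n + l)%N) | s < n.+1].

Lemma corner_frame_sub r : sub_sum p [set i]%SET (corner_frame r).
Proof.
rewrite /corner_frame; case: ifP => rn; split.
- exact: (sum_ell_basis hp).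
- move=> k; rewrite inE => ki; rewrite /basis_vec (_ : (k == _) = false)//.
  by apply: contraNF ki => /eqP ->.
- apply: (sum_ell_inj hp); apply/ellP; exists 1 => q uq _.
  have uq' : uniq [seq (l - n)%N | l <- q & (n <= l)%N].
    rewrite map_inj_in_uniq ?filter_uniq// => a b.
    by rewrite !mem_filter => /andP[na _] /andP[nb _]; lia.
  apply: le_trans (dyadic_seq_summable R uq').
  rewrite big_map big_filter (bigID (fun l => (n <= l)%N))/= addrC big1 ?add0r; last first.
    by move=> l; rewrite -ltnNge => ->; rewrite modulus0 powR0// gt_eqF.
  apply: ler_sum => l nl; rewrite ltnNge nl /= modulus_real ?(ltW (u_gt0 _))//.
  by rewrite /u -powRrM mulVf ?gt_eqF// powRr1// ltW// dyadic_seq_gt0.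
- by move=> k; rewrite inE /inj_vec => /negbTE ->.
Qed.

Lemma corner_indexE l (s : 'I_n.+1) :
  tnth (corner_index l) s = (i, if (s < n)%N then s : nat else (n + l)%N).
Proof. by rewrite tnth_mktuple. Qed.

Lemma plucker_corner l : plucker corner_frame (corner_index l) = (u l)%:C%C.
Proof.
have entry (r s : 'I_n.+1) : corner_frame r (tnth (corner_index l) s) =
    if r == s then (if (r < n)%N then 1 else (u l)%:C%C) else 0.
  rewrite corner_indexE /corner_frame; have rs : (r < n.+1)%N := ltn_ord r.
  have ss : (s < n.+1)%N := ltn_ord s; rewrite -val_eqE /=.
  case: ifP => rn.
    rewrite /basis_vec xpair_eqE eqxx /=; case: ifP => sn; first by rewrite eq_sym; case: eqP.
    have -> : (r == s :> nat) = false by apply/negbTE; lia.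
    by have -> : ((n + l)%N == r :> nat) = false by apply/negbTE; lia.
  rewrite /inj_vec /= eqxx; have [sn|sn] := boolP (s < n)%N.
    by rewrite sn; have -> : (r == s :> nat) = false by apply/negbTE; lia.
  rewrite ltnNge leq_addr /= addKn; have -> : (r == s :> nat) by lia.
  by [].
rewrite /plucker det_trig.
  rewrite big_ord_recr /= mxE entry eqxx ltnn big1 ?mul1r// => r _.
  by rewrite mxE entry eqxx /= ltn_ord.
apply/is_trig_mxP => r s rs; rewrite mxE entry; case: eqP => // rsE.
by rewrite rsE ltnn in rs.
Qed.

Lemma corner_frame_nframe : nframe p corner_frame.
Proof.
split; last by move=> r; case: (corner_frame_sub r).
move=> c c0 r; pose M := \matrix_(r, s) corner_frame r (tnth (corner_index 0) s).
have Mu : M \in unitmx.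
  rewrite unitmxE unitfE -/(plucker _ _) plucker_corner fmorph_eq0 gt_eqF//.
have : \row_r c r *m M = 0.
  apply/rowP => s; rewrite !mxE.
  transitivity ((\sum_r c r *: corner_frame r) (tnth (corner_index 0) s)); last by rewrite c0.
  by rewrite vect_combE; apply: eq_bigr => q _; rewrite !mxE.
by move/(canRL (mulmxK Mu)); rewrite mul0mx => /rowP /(_ r); rewrite !mxE.
Qed.

Lemma corner_index_sorted l : nsubsets (corner_index l).
Proof.
change (sorted <%O (corner_index l : seq (idx m))).
apply/(sortedP (i, 0%N)) => s; rewrite size_tuple => sn.
have s1 : (s < n.+1)%N by exact: ltnW.
rewrite -[s]/(val (Ordinal s1)) -[s.+1]/(val (Ordinal sn)) -!tnth_nth !corner_indexE /=.
rewrite Order.ProdLexiOrder.ltEprodlexi /= lexx /= ltEnat /=.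
by case: ifP; case: ifP; lia.
Qed.

Lemma corner_index_inj : injective corner_index.
Proof.
move=> l l' /(congr1 (fun I => tnth I ord_max)); rewrite !corner_indexE /= ltnn.
by move=> [] /addnI.
Qed.

(** Over the corner indices the sum of [|p_I|^t] is the sum of [dyadic_seq ^ (t / p_i)], unbounded
    when [t < p_i]. *)
Lemma corner_plucker_ell t : 0 < t -> all_plucker_ell corner_frame t -> p i <= t.
Proof.
move=> t0 /ellP[M hM]; rewrite leNgt; apply/negP => tp.
have th0 : 0 < t / p i by rewrite divr_gt0.
have th1 : t / p i < 1 by rewrite ltr_pdivrMr// mul1r.
have [L ML] := dyadic_seq_powR_unbounded M th0 th1.
have := hM (map corner_index (dyadic_block L)) _ _; rewrite big_map => h.
move: ML; rewrite ltNge => /negP; apply; apply: le_trans (h _ _).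
- rewrite le_eqVlt; apply/orP; left; apply/eqP; apply: eq_bigr => l _.
  rewrite plucker_corner modulus_real ?(ltW (u_gt0 _))// /u -powRrM.
  by rewrite mulrC.
- by rewrite (map_inj_uniq corner_index_inj) iota_uniq.
- by move=> _ /mapP[l _ ->]; exact: corner_index_sorted.
Qed.

End PureCorner.

Lemma global_exponent (R : realType) (m n : nat) (p : 'I_m -> R) :
  (1 <= m)%N -> (1 <= n)%N -> (forall i, 1 <= p i) ->
  let pmax := \big[Order.max/0]_(i < m) p i in
  is_global_exponent n p pmax /\
  forall i, p i = pmax -> exists w : 'I_n -> vect R m,
    [/\ nframe p w, forall r, sub_sum p [set i]%SET (w r)
      & forall t, 0 < t -> all_plucker_ell w t <-> pmax <= t].
Proof.
case: n => // n hm _ hp pmax.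
have p_le i : p i <= pmax by exact: le_bigmax.
have [i0 i0E] : exists i, p i = pmax.
  (* The default value 0 of the maximum is below every [p i], so with [m >= 1] the maximum is
     attained at some color. *)
  have [i _ pE] :=
    eq_bigmax (x := 0) (Ordinal hm) xpredT p isT (fun i _ => le_trans ler01 (hp i)).
  by exists i.
have pmax0 : 0 < pmax by rewrite -i0E; exact: lt_le_trans ltr01 (hp i0).
have up v t : nframe p v -> pmax <= t -> all_plucker_ell v t.
  move=> [_ Xv] pt; apply: (plucker_ell hp) Xv => [|i]; first exact: lt_le_trans pt.
  exact: le_trans pt.
split.
  split=> [|t [t0 ht]]; first by split=> // v fv; exact: up.
  rewrite -i0E; apply: (@corner_plucker_ell R m n p hp i0 t t0).
  exact/ht/corner_frame_nframe.
move=> i iE; exists (@corner_frame R m n p i); split.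
- exact: corner_frame_nframe.
- exact: corner_frame_sub.
- move=> t t0; split; first by rewrite -iE; exact: corner_plucker_ell.
  by apply: up; exact: corner_frame_nframe.
Qed.

Theorem theorem6p6 (R : realType) (m n : nat) (p : 'I_m -> R)
    (N : 'rV[R]_m -> R) (V : set (vect R m)) (v : 'I_n -> vect R m)
    (hm : (1 <= m)%N) (hn : (1 <= n)%N) (hp : forall i, 1 <= p i)
    (hN : absolute_norm N) (hV : Gr n p V) (hv : is_basis v V) :
  let pmax := \big[Order.max/0]_(i < m) p i in
  (generalized_permutohedron (polytope n V) /\
   plucker_support v = lattice_points (polytope n V) /\
   polytope n V = polytope_lower n p V /\
   M_convex (plucker_support v)) /\
  (polytope n V = base_polytope v /\
   forall (a : 'rV[int]_m) (c : 'I_n -> 'I_m),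
     (forall i, a ord0 i = #|[set r | c r == i]%SET|%:Z) ->
     (plucker_support v a <-> indep_transversal v c) /\
     (indep_transversal v c <-> Rado_condition v c)) /\
  (forall i1 i2 : 'I_m, m = 2%N -> i1 = 0%N :> nat -> i2 = 1%N :> nat ->
     forall a : 'rV[int]_m, plucker_support v a <->
       [/\ (subspace_dim (V `&` sub_sum p [set i1]%SET))%:Z <= a ord0 i1,
           a ord0 i1 <= n%:Z - (subspace_dim (V `&` sub_sum p [set i2]%SET))%:Z
         & a ord0 i2 = n%:Z - a ord0 i1]) /\
  (is_global_exponent n p pmax /\
   forall i, p i = pmax ->
     exists w : 'I_n -> vect R m,
       [/\ nframe p w, forall r, sub_sum p [set i]%SET (w r)
         & forall t, 0 < t -> all_plucker_ell w t <-> pmax <= t]) /\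
  (injective p -> (forall i, p i != 2) -> normalized N -> strictly_monotone N ->
   Isom p N = prod_Isom p /\
   forall T, Isom p N T ->
     forall S, face_stratification n p S -> [set T @` W | W in S] = S).
Proof.
have [_ Vp] := hV.
move=> pmax; split; last split; last split; last split.
- split; first exact: (polytope_permutohedron hv).
  split; first exact: (support_lattice_points hm hv).
  by split; [rewrite (polytope_lowerE hv Vp)|exact: (support_M_convex hm hv)].
- split; first exact: (polytope_base_polytope hm hv).
  by move=> a c ac; exact: (support_Rado hm hv ac).
- by move=> i1 i2 m2 e1 e2 a; exact: (support_two_colors hm a hv Vp m2 e1 e2).
- exact: global_exponent.
- move=> p_inj p2 nN _; split; first exact: (Isom_prod_Isom hp p2 p_inj hN nN).
  move=> T isoT S; exact: (face_stratification_isom hp p2 p_inj hN nN isoT).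
Qed.
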